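(* Consider the problem $(GP)$ with data $F,\phi,\omega,t_0,T,\lambda,\sigma,k_0$ as described in the context. If both functions $\omega:\mathbb{R}_+\to\mathbb{R}$ and $\phi:\mathbb{R}_+\to\mathbb{R}_+$ are continuous and concave on $\mathbb{R}_+$, then $(GP)$ has a global solution.
   Context: $\mathbb{R}_+=[0,+\infty)$. Data: a production function $F:\mathbb{R}_+^2\to\mathbb{R}_+$ with $F(\alpha K,\alpha L)=\alpha F(K,L)$ for all $\alpha>0$ and $(K,L)\in\mathbb{R}_+^2$; the per capita production function $\phi:\mathbb{R}_+\to\mathbb{R}_+$, $\phi(k):=F(k,1)$; a utility function $\omega:\mathbb{R}_+\to\mathbb{R}$; real parameters $T>t_0\ge 0$ (finite), $\lambda\ge 0$, $\sigma>0$, $k_0>0$. Problem $(GP)$: maximize $$I(k,s):=\int_{t_0}^{T}\omega\big[(1-s(t))\phi(k(t))\big]e^{-\lambda t}\,dt$$ over pairs $(k,s)$ with $k\in W^{1,1}([t_0,T],\mathbb{R})$ (i.e. $k$ absolutely continuous on $[t_0,T]$) and $s:[t_0,T]\to\mathbb{R}$ Lebesgue measurable satisfying $\dot k(t)=s(t)\phi(k(t))-\sigma k(t)$ for a.e. $t\in[t_0,T]$; $k(t_0)=k_0$; $s(t)\in[0,1]$ for a.e. $t\in[t_0,T]$; $k(t)\ge 0$ for all $t\in[t_0,T]$. A pair $(k,s)$ satisfying these requirements for which the integrand of $I$ is Lebesgue integrable is called a feasible process. A global solution of $(GP)$ is a feasible process $(\bar k,\bar s)$ such that $I(k,s)\le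 I(\bar k,\bar s)$ for every feasible process $(k,s)$. *)

(* Defs.v *)
From HB Require Import structures.
From mathcomp Require Import all_boot all_order all_algebra.
From mathcomp Require Import all_classical all_reals all_analysis.

Set Implicit Arguments.
Unset Strict Implicit.
Unset Printing Implicit Defensive.
Import Order.TTheory GRing.Theory Num.Theory.
Import numFieldNormedType.Exports.

Local Open Scope classical_set_scope.
Local Open Scope ring_scope.
Local Open Scope convex_scope.

(* R with the sigma-algebra of Lebesgue measurable sets, i.e., the domain of
   [completed_lebesgue_measure]; the default sigma-algebra on R is the Borel
   one. As a type it is convertible to R. *)
Notation lebesgueType R := (caratheodory_type (@wlength R idfun)^*%mu).

Section real_functions.
Context {R : realType}.

Definition concave_function (D : set R) (f : R -> R) :=
  forall t : {i01 R}, {in D &, forall x y : convex_lmodType R^o,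
    (f x : convex_lmodType R^o) <| t |> f y <= f (x <| t |> y) :> R}.

(* Intervals are compared through their interiors, so that they may share
   endpoints. *)
Definition absolutely_continuous (a b : R) (f : R -> R) :=
  forall e : R, 0 < e -> exists2 d : R, 0 < d &
    forall (n : nat) (u v : 'I_n -> R),
      (forall i, a <= u i <= v i /\ v i <= b) ->
      trivIset setT (fun i => `]u i, v i[%classic) ->
      \sum_(i < n) (v i - u i) < d ->
      \sum_(i < n) `|f (v i) - f (u i)| < e.

End real_functions.

Section growth_problem.
Context {R : realType}.
Variables (F : R -> R -> R) (omega : R -> R) (t0 T lambda sigma k0 : R).

Notation mu := (@completed_lebesgue_measure R).

(* Functions on R_+ are encoded as total functions on R whose values at
   negative points are unconstrained. *)
Definition production_function :=
  (forall K L, 0 <= K -> 0 <= L -> 0 <= F K L) /\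
  (forall a K L, 0 < a -> 0 <= K -> 0 <= L -> F (a * K) (a * L) = a * F K L).

Definition per_capita (k : R) : R := F k 1.

Local Notation phi := per_capita.

(* For a feasible process the argument of omega can be negative only on the null
   set where s t lies outside [0, 1]; as [mu] is complete, the values of omega
   there affect neither integrability nor the integral. *)
Definition integrand (k s : R -> R) (t : R) : R :=
  omega ((1 - s t) * phi (k t)) * expR (- lambda * t).

(* Only the values of k and s on [t0, T] matter: the derivative below is
   two-sided, but the two endpoints form a null set. *)
Record feasible_process (k s : R -> R) : Prop := FeasibleProcess {
  state_ac : absolutely_continuous t0 T k ;
  control_measurable :
    measurable_fun (`[t0, T]%classic : set (lebesgueType R))
      (s : lebesgueType R -> R) ;
  state_equation : {ae mu, forall t : R, t \in `[t0, T] ->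
    is_derive t 1 k (s t * phi (k t) - sigma * k t)} ;
  state_initial : k t0 = k0 ;
  control_bounds : {ae mu, forall t : R, t \in `[t0, T] -> 0 <= s t <= 1} ;
  state_ge0 : forall t : R, t \in `[t0, T] -> 0 <= k t ;
  integrand_integrable : mu.-integrable `[t0, T] (EFin \o integrand k s)
}.

Definition objective (k s : R -> R) : R :=
  \int[mu]_(t in `[t0, T]) integrand k s t.

Definition global_solution (k s : R -> R) :=
  feasible_process k s /\
  forall k' s' : R -> R, feasible_process k' s' ->
    objective k' s' <= objective k s.

End growth_problem.

(* Main.v *)
Require Import Defs.
From HB Require Import structures.
From mathcomp Require Import all_boot all_order all_algebra.
From mathcomp Require Import all_classical all_reals all_analysis.
From mathcomp Require Import measurable_realfun ring lra.
Set Implicit Arguments.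
Unset Strict Implicit.
Unset Printing Implicit Defensive.
Import Order.TTheory GRing.Theory Num.Theory.
Import numFieldNormedType.Exports.
Local Open Scope classical_set_scope.
Local Open Scope ring_scope.

(** The proof is the direct method.  Write u = s phi(k) for the investment, so
that k' = u - sigma k, 0 <= u <= phi(k), and the payoff at time t is
omega(phi(k) - u) e^(-lambda t).

A priori bounds.  Since phi is concave and nonnegative,
phi(x) <= 2 phi(1) (1 + x) ([concave_linear_growth]).  Hence
(ln (1 + k))' <= 2 phi(1) almost everywhere, all states are bounded by one
constant B and are Lipschitz with one constant L.  Passing from almost
everywhere bounds on the derivative to bounds on increments is where absolute
continuity enters ([ae_derive_le_increment]).  Using the Lebesgue differentiation
theorem, feasible processes correspond to pairs (k, u), called [admissible] below,
with u Borel measurable and k(x) = k0 + int_[t0,x] (u - sigma k), with the same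
value of the objective ([feasible_admissible], [admissible_feasible]).

Compactness.  A maximizing sequence of states has a uniform cluster point k
([equiLipschitz_cluster], from Tychonoff's theorem).  The problem is not jointly
concave in (k, u), because omega need not be monotone, but it is concave in u
once k is fixed.  So let C_n be the set of the investments g with
0 <= g <= phi(k) which satisfy the integrated state equation for the limit state
k up to 1/(n+1) and whose total payoff along k is at least the supremum minus
1/(n+1).  Uniform continuity of phi and omega shows that C_n is nonempty
([near_optimal_nonempty]): it contains min(u_i, phi(k)) for a suitable term
(k_i, u_i) of the maximizing sequence.  Concavity of omega makes C_n convex, and
C_n decreases with n.  In place of a weak compactness theorem, elements of C_n of
almost minimal L2 norm form, by the parallelogram identity, a sequence h_j in C_j
which converges almost everywhere ([decreasing_convex_ae_cvg]).  By dominated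
convergence its limit u satisfies the constraints with no error, and (k, u) is
optimal ([near_optimal_limit]). *)

(** * Completed and Borel Lebesgue measure *)

(** Lebesgue measure on the Lebesgue measurable sets, and its restriction to the
Borel sets. *)
Notation clebesgue R := (@completed_lebesgue_measure R).
Notation lebesgue R := (@lebesgue_measure R).

Lemma completed_negligibleP (R : realType) (A : set R) :
  (clebesgue R).-negligible A <-> (lebesgue R).-negligible A.
Proof.
split=> [[B [mB B0 AB]]|[B [mB B0 AB]]].
  have [C [mC C0 BC]] : (lebesgue R).-negligible B.
    by apply/negligible_outer_measure; exact: B0.
  by exists C; split => //; exact: subset_trans BC.
exists B; split => //; exact: sub_caratheodory.
Qed.

Lemma completed_aeP (R : realType) (P : R -> Prop) :
  {ae clebesgue R, forall x, P x} <-> {ae lebesgue R, forall x, P x}.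
Proof. exact: completed_negligibleP. Qed.

Lemma measurable_id_completed (R : realType) :
  measurable_fun (setT : set (lebesgueType R)) (id : lebesgueType R -> measurableTypeR R).
Proof. by move=> _ B mB; rewrite setTI; exact: sub_caratheodory. Qed.

Lemma measurable_completed (R : realType) (D : set R) :
  measurable D -> measurable (D : set (lebesgueType R)).
Proof. exact: sub_caratheodory. Qed.

Lemma measurable_fun_completed (R : realType) d (U : measurableType d) (D : set R)
    (f : R -> U) : measurable D ->
  measurable_fun D f ->
  measurable_fun (D : set (lebesgueType R)) (f : lebesgueType R -> U).
Proof. by move=> mD mf _ B mB; apply: measurable_completed; exact: mf. Qed.

(** The Borel measure is the push-forward of the completed one along the identity. *)
Lemma completed_integral (R : realType) (D : set R) (f : R -> \bar R) :
  measurable D -> measurable_fun [set: R] f ->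
  (clebesgue R).-integrable D f ->
  (\int[clebesgue R]_(x in D) f x = \int[lebesgue R]_(x in D) f x)%E.
Proof.
move=> mD mf intf.
have := @integral_pushforward _ _ _ _ _ _ (@measurable_id_completed R) (clebesgue R) D f mf intf mD.
move=> <-.
apply: (eq_measure_integral (lebesgue R)); first exact: measurable_id_completed.
by move=> A mA _.
Qed.

#[local] Instance lebesgue_ae_filter (R : realType) :
  Filter (nbhs (almost_everywhere (lebesgue R))).
Proof. exact: (ae_filter_ringOfSetsType (lebesgue R)). Qed.

Lemma ae_eq_integrable d (U : measurableType d) (R : realType)
    (mu : {measure set U -> \bar R}) (D : set U) (f g : U -> \bar R) :
  measurable D -> measurable_fun D f -> measurable_fun D g ->
  ae_eq mu D f g -> mu.-integrable D f -> mu.-integrable D g.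
Proof.
move=> mD mf mg fg /integrableP[_ fi]; apply/integrableP; split => //.
rewrite -(@ae_eq_integral _ _ _ mu D (abse \o g) (abse \o f))//.
- exact: measurableT_comp.
- exact: measurableT_comp.
- exact: ae_eq_abse.
Qed.

Lemma ae_neq (R : realType) (c : R) : {ae lebesgue R, forall t, t != c}.
Proof.
exists [set c]; split => //; first exact: lebesgue_measure_set1.
by move=> t /= /negP; rewrite negbK => /eqP.
Qed.

(** * Increments of absolutely continuous functions *)

Lemma is_derive_expansion (R : realType) (f : R -> R) (t d e : R) :
  is_derive t 1 f d -> 0 < e ->
  exists2 eta : R, 0 < eta &
    forall y, `|y - t| < eta -> `|f y - f t - d * (y - t)| <= e * `|y - t|.
Proof.
move=> [df dE] e0.
have {df dE} : h^-1 *: ((f \o shift t) (h *: 1) - f t) @[h --> 0^'] --> d.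
  by rewrite -dE; exact: df.
move/cvgrPdist_lt => /(_ _ e0) /nbhs_ballP[eta /= eta0 H].
exists eta => // y yt; have [->|yNt] := eqVneq y t.
  by rewrite !subrr mulr0 subr0 !normr0 mulr0.
have h0 : y - t != 0 by rewrite subr_eq0.
have := H (y - t); rewrite /ball /= sub0r normrN => /(_ yt h0).
rewrite scaler1 subrK => /ltW.
have n0 : 0 < `|y - t| by rewrite normr_gt0.
rewrite -(ler_pM2r n0) -normrM; apply: le_trans.
rewrite -normrN opprB mulrBl /GRing.scale/= mulrAC mulVf// mul1r.
by rewrite lexx.
Qed.

(** Induction along an interval: a property of points of [a, b] which propagates
across a neighbourhood of every point passes from a to b.  It replaces arguments
by compactness of [a, b]. *)
Lemma real_induction (R : realType) (a b : R) (P : R -> Prop) :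
  a <= b -> P a ->
  (forall t, a <= t <= b -> exists2 eta : R, 0 < eta &
    forall x y, a <= x <= t -> t <= y <= b -> t - x < eta -> y - t < eta ->
      P x -> P y) ->
  P b.
Proof.
move=> ab Pa step; pose S := [set x | a <= x <= b /\ P x].
have Sa : S a by split; rewrite ?lexx.
have ubS : ubound S b by move=> x [/andP[]].
have supS : has_sup S by split; [exists a|exists b].
have ac : a <= sup S by apply: ub_le_sup => //; exists b.
have cb : sup S <= b by apply: ge_sup => //; exists a.
have [|eta eta0 H] := step (sup S); first by rewrite ac.
have [x [/andP[ax xb] Px] cx] := sup_adherent eta0 supS.
have xc : x <= sup S by apply: ub_le_sup; [exists b|split => //; rewrite ax].
have [bc|bc] := leP b (sup S + eta / 2).
  apply: (H x) => //; [by rewrite ax|by rewrite cb lexx|lra|lra].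
have : S (sup S + eta / 2).
  split; first by apply/andP; split; lra.
  apply: (H x) => //; [by rewrite ax|by apply/andP; split; lra|lra|lra].
move=> /(ub_le_sup (x := _) (ex_intro _ b ubS)); lra.
Qed.

(** Consecutive intervals inside O are disjoint, and their total length is at most
the measure of O. *)
Lemma sum_disjoint_itv_le (R : realType) (n : nat) (u v : nat -> R) (O : set R) :
  measurable O ->
  (forall i, (i < n)%N -> u i <= v i) ->
  (forall i j, (i < j < n)%N -> v i <= u j) ->
  (forall i, (i < n)%N -> `]u i, v i[%classic `<=` O) ->
  trivIset setT (fun i : 'I_n => `]u i, v i[%classic) /\
  ((\sum_(i < n) (v i - u i))%:E <= lebesgue R O)%E.
Proof.
move=> mO uv vu uvO.
have tI : trivIset setT (fun i : 'I_n => `]u i, v i[%classic).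
  move=> i j _ _ [x /= []]; rewrite !in_itv/= => /andP[ui vi] /andP[uj vj].
  apply: val_inj => /=; case: (ltngtP i j) => // ij; exfalso.
  - have := vu i j; rewrite ij ltn_ord => /(_ isT) vij {ij}; lra.
  - have := vu j i; rewrite ij ltn_ord => /(_ isT) vij {ij}; lra.
split => //.
have mF (i : 'I_n) : measurable `]u i, v i[%classic by exact: measurable_itv.
have mU : measurable (\big[setU/set0]_(i < n) `]u i, v i[%classic).
  by apply: bigsetU_measurable => i _.
rewrite -sumEFin.
under eq_bigr => i _.
  rewrite (_ : (v i - u i)%:E = lebesgue R `]u i, v i[%classic); last first.
    rewrite lebesgue_measure_itv/= lte_fin; case: ltP => [//|vu'].
    by apply/eqP; rewrite eqe subr_eq0 eq_le vu' uv.
  over.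
rewrite -measure_semi_additive_ord//.
apply: le_measure; rewrite ?inE//.
rewrite -(bigcup_mkord n (fun i => `]u i, v i[%classic)).
by apply: bigcup_sub => i; exact: uvO.
Qed.

(** An absolutely continuous function whose derivative is almost everywhere at most
C increases by at most C (b - a).  Cover the exceptional null set by an open set O
of measure less than the delta of absolute continuity: near a good point the
increments are controlled by the derivative, near a bad point the interval lies in
O and its increment is charged to a family of disjoint intervals of O. *)
Lemma ae_derive_le_increment (R : realType) (f : R -> R) (a b C : R) :
  a <= b -> 0 <= C -> absolutely_continuous a b f ->
  {ae lebesgue R, forall t, t \in `[a, b] ->
    exists2 d, is_derive t 1 f d & d <= C} ->
  f b - f a <= C * (b - a).
Proof.
move=> ab C0 fac [N [mN N0 HN]].
have ba0 : 0 <= b - a by rewrite subr_ge0.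
apply/ler_addgt0Pr => e' e'0.
pose e := e' / (b - a + 1).
have e0 : 0 < e by rewrite divr_gt0// ltr_wpDl.
have ee' : e * (b - a) + e = e'.
  by rewrite -[X in _ + X]mulr1 -mulrDr /e divfK// gt_eqF// ltr_wpDl.
have [delta delta0 Hdelta] := fac e e0.
have Nfin : (lebesgue R N < +oo)%E := eq_ind_r (fun z => z < +oo)%E (ltry 0) N0.
have [ O [oO NO OND]] := lebesgue_regularity_outer mN Nfin delta0.
have mO : measurable O by exact: open_measurable.
have Od : (lebesgue R O < delta%:E)%E.
  rewrite -(setDUK NO) setUC; apply: le_lt_trans OND.
  apply: (@le_trans _ _ (lebesgue R (O `\` N) + lebesgue R N)%E).
    by apply: measureU2 => //; exact: measurableD.
  by rewrite [X in (_ + X)%E]N0 adde0.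
(* P x: the increment over [a, x] is at most (C + e) (x - a) plus the variation of
   f over finitely many consecutive intervals contained in O. *)
pose P x := exists (n : nat) (u v : nat -> R),
  [/\ forall i, (i < n)%N -> a <= u i <= v i /\ v i <= x,
      forall i j, (i < j < n)%N -> v i <= u j,
      forall i, (i < n)%N -> `]u i, v i[%classic `<=` O &
      f x - f a <= (C + e) * (x - a) + \sum_(i < n) `|f (v i) - f (u i)|].
suff [n [u [v [uv vu uvO fE]]]] : P b.
  have [|tI] := sum_disjoint_itv_le mO _ vu uvO.
    by move=> i /uv[/andP[]].
  move=> /le_lt_trans/(_ Od); rewrite lte_fin => S.
  have := Hdelta n (fun i => u i) (fun i => v i) _ tI S.
  move=> /(_ (fun i => uv _ (ltn_ord i))) => E.
  by rewrite (le_trans fE)//; nra.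
apply: (@real_induction _ a b) => //.
  exists 0%N, (fun=> 0), (fun=> 0); split=> //.
  by rewrite big_ord0 !subrr mulr0 addr0.
move=> t /andP[at_ tb].
have [eta eta0 Heta] : exists2 eta : R, 0 < eta & forall x y,
    x <= t -> t <= y -> t - x < eta -> y - t < eta ->
    f y - f x <= (C + e) * (y - x) \/ `]x, y[%classic `<=` O.
  have [Nt|Nt] := pselect (N t).
    have /nbhs_ballP[eta /= eta0 H] : nbhs t O.
      by apply: open_nbhs_nbhs; split => //; exact: NO.
    exists eta => // x y xt ty tx yt; right => z /=; rewrite in_itv/= => /andP[xz zy].
    by apply: H; rewrite /ball/= ltr_distlC; apply/andP; split; lra.
  have [d df dC] : exists2 d, is_derive t 1 f d & d <= C.
    apply: contrapT => nd; apply: Nt; apply: HN => /=.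
    by move=> H; apply: nd; apply: H; rewrite in_itv/= at_.
  have [eta eta0 H] := is_derive_expansion df e0.
  exists eta => // x y xt ty tx yt; left.
  have := H x; rewrite distrC ger0_norm ?subr_ge0// => /(_ tx).
  rewrite ler_norml => /andP[H1 H2].
  have := H y; rewrite ger0_norm ?subr_ge0// => /(_ yt).
  rewrite ler_norml => /andP[H3 H4].
  nra.
exists eta => // x y /andP[ax xt] /andP[ty yb] tx yt [n [u [v [uv vu uvO fE]]]].
have xy : x <= y by exact: le_trans ty.
(* In the first case the family of intervals is kept, in the second one the interval
   ]x, y[ is appended to it. *)
have [fxy|xyO] := Heta x y xt ty tx yt.
  exists n, u, v; split => //.
    by move=> i /uv[uvi vix]; split => //; exact: le_trans xy.
  nra.
exists n.+1, (fun i => if (i < n)%N then u i else x),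
  (fun i => if (i < n)%N then v i else y); split.
- move=> i _; case: ifPn => [/uv[uvi vix]|_]; last by rewrite ax xy.
  by split => //; exact: le_trans xy.
- move=> i j /andP[ij]; rewrite ltnS leq_eqVlt => /orP[/eqP jn|jn].
    by rewrite -jn ij ltnn; have [] := uv i; rewrite -?jn.
  by rewrite jn (ltn_trans ij jn); apply: vu; rewrite ij.
- by move=> i _; case: ifPn => // /uvO.
- rewrite big_ord_recr/= ltnn.
  under eq_bigr => i _ do rewrite ltn_ord.
  have := ler_norm (f y - f x); nra.
Qed.

(** * Primitives of bounded Borel functions *)

Lemma integrable_bounded_itv (R : realType) (g : R -> R) (a b L : R) :
  measurable_fun `[a, b] g -> (forall t, a <= t <= b -> `|g t| <= L) ->
  (lebesgue R).-integrable `[a, b] (EFin \o g).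
Proof.
move=> mg gL; apply: measurable_bounded_integrable => //.
  by rewrite [ltLHS]lebesgue_measure_itv/=; case: ifPn => // _; rewrite -EFinB ltry.
exists L; split; first exact: num_real.
move=> M LM t /=; rewrite in_itv/= => /gL /le_trans; apply; exact: ltW.
Qed.

Lemma Rintegral_norm_le_itv (R : realType) (g : R -> R) (a b L : R) :
  a <= b -> measurable_fun `[a, b] g -> (forall t, a <= t <= b -> `|g t| <= L) ->
  `|\int[lebesgue R]_(t in `[a, b]) g t| <= L * (b - a).
Proof.
move=> ab mg gL.
have ig := integrable_bounded_itv mg gL.
apply: (le_trans (le_normr_Rintegral _ ig)) => //.
apply: (@le_trans _ _ (\int[lebesgue R]_(t in `[a, b]) L)).
  apply: le_Rintegral => //.
  - apply: (@integrable_bounded_itv _ _ _ _ L); first exact: measurableT_comp.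
    by move=> t /gL; rewrite normr_id.
  - apply: (@integrable_bounded_itv _ _ _ _ `|L|); first exact: measurable_cst.
    by move=> t _ /=.
rewrite Rintegral_cst// [X in fine X]lebesgue_measure_itv/= lte_fin.
case: ltP => //= ba; have -> : b = a by apply/le_anti; rewrite ab ba.
by rewrite subrr.
Qed.

Lemma Rintegral_itv_split (R : realType) (g : R -> R) (a b c : R) :
  a <= b -> b <= c -> (lebesgue R).-integrable `[a, c] (EFin \o g) ->
  \int[lebesgue R]_(t in `[a, c]) g t =
  \int[lebesgue R]_(t in `[a, b]) g t + \int[lebesgue R]_(t in `[b, c]) g t.
Proof.
move=> ab bc ig.
have := @Rintegral_itvB _ g (BLeft a) (BRight c) b ig.
rewrite !bnd_simp => /(_ ab bc) /eqP; rewrite subr_eq addrC => /eqP ->.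
congr (_ + _); apply: Rintegral_itv_obnd_cbnd.
apply: integrableS ig => //.
by apply: subset_itv; rewrite bnd_simp.
Qed.

Section primitive.
Variables (R : realType) (g : R -> R) (a L : R).
Hypotheses (mg : measurable_fun [set: R] g) (gL : forall t, `|g t| <= L).

Let V (x : R) := \int[lebesgue R]_(t in `[a, x]) g t.

Lemma primitive_Lipschitz x y : a <= x -> x <= y -> `|V y - V x| <= L * (y - x).
Proof.
move=> ax xy; rewrite /V (@Rintegral_itv_split _ _ a x y)//; last first.
  by apply: (@integrable_bounded_itv _ _ _ _ L) => //; exact: measurable_funTS.
rewrite addrAC subrr add0r; apply: Rintegral_norm_le_itv => //.
exact: measurable_funTS.
Qed.

(** Lebesgue differentiation theorem for the primitive of a bounded Borel function. *)
Lemma ae_derive_primitive :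
  {ae lebesgue R, forall t, a < t -> is_derive t 1 V (g t)}.
Proof.
have H := @FTC1 R g (BLeft a) _ _.
have {H} : {ae lebesgue R, forall t, a < t -> derivable V t 1 /\ derive1 V t = g t}.
  apply: H.
    by move=> y; apply: (@integrable_bounded_itv _ _ _ _ L) => //; exact: measurable_funTS.
  split => //; first exact: openT.
  move=> K _ cK.
  have : (lebesgue R).-integrable K (EFin \o g).
    apply: measurable_bounded_integrable => //.
    - exact: compact_measurable.
    - exact: compact_finite_measure.
    - exact: measurable_funTS.
    exists L; split; first exact: num_real.
    by move=> M LM t _; exact: (le_trans (gL t) (ltW LM)).
  by move=> /integrableP[].
apply: filterS => t H /H[H1 H2]; split; first exact: H1.
by rewrite -derive1E; exact: H2.
Qed.

End primitive.

(** * Decreasing sequences of convex sets of bounded functions *)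

(** On a set of finite measure, a decreasing sequence of nonempty, uniformly
bounded, midpoint-convex sets C_n of measurable functions admits a selection
h_j in C_j that converges almost everywhere. *)
Section decreasing_convex_sets.
Variables (d : measure_display) (T : measurableType d) (R : realType).
Variables (mu : {measure set T -> \bar R}) (D : set T) (B : R).
Hypotheses (mD : measurable D) (muD : (mu D < +oo)%E).

Let bint (f : T -> R) L : measurable_fun D f -> (forall t, D t -> `|f t| <= L) ->
  mu.-integrable D (EFin \o f).
Proof.
move=> mf fL; apply: measurable_bounded_integrable => //.
exists L; split; first exact: num_real.
by move=> M LM t /fL /le_trans; apply; exact: ltW.
Qed.

Variable C : nat -> set (T -> R).
Hypotheses
  (C_measurable : forall n g, C n g -> measurable_fun D g)
  (C_bounded : forall n g t, C n g -> D t -> `|g t| <= B)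
  (C_midpoint : forall n f g, C n f -> C n g -> C n (fun t => (f t + g t) / 2))
  (C_decreasing : forall m n, (m <= n)%N -> C n `<=` C m)
  (C_nonempty : forall n, C n !=set0).

(* N is the squared L2 norm on D, I n its infimum on C n, J the limit of I n. *)
Let N (g : T -> R) := \int[mu]_(t in D) g t ^+ 2.

Let sq_bound (x : R) : `|x| <= B -> `|x ^+ 2| <= B ^+ 2.
Proof. by move=> xB; rewrite normrX ler_pXn2r// nnegrE (le_trans _ xB). Qed.

Let int_sq n g : C n g -> mu.-integrable D (EFin \o (fun t => g t ^+ 2)).
Proof.
move=> Cg; apply: (@bint _ (B ^+ 2)).
  by apply: measurable_funX; exact: C_measurable Cg.
by move=> t Dt; apply: sq_bound; exact: C_bounded Cg Dt.
Qed.

Let N_le n g : C n g -> 0 <= N g <= B ^+ 2 * fine (mu D).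
Proof.
move=> Cg; apply/andP; split; first by apply: Rintegral_ge0 => t _; exact: sqr_ge0.
rewrite -Rintegral_cst//; apply: le_Rintegral => //.
- exact: int_sq Cg.
- by apply: (@bint _ `|B ^+ 2|).
- move=> t Dt; apply: (le_trans (ler_norm _)).
  by apply: sq_bound; exact: C_bounded Cg Dt.
Qed.

Let I n := inf [set N g | g in C n].

Let hasI n : has_inf [set N g | g in C n].
Proof.
split; first by have [g Cg] := C_nonempty n; exists (N g), g.
by exists 0 => _ [g /N_le/andP[? _] <-].
Qed.

Let I_le n g : C n g -> I n <= N g.
Proof. by move=> Cg; apply: ge_inf; [exact: (hasI n).2|exists g]. Qed.

Let I_mono m n : (m <= n)%N -> I m <= I n.
Proof.
move=> mn; apply: lb_le_inf; first exact: (hasI n).1.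
by move=> _ [g /(C_decreasing mn) Cg <-]; exact: I_le.
Qed.

Let J := sup (range I).

Let hasJ : has_sup (range I).
Proof.
split; first by exists (I 0%N), 0%N.
exists (B ^+ 2 * fine (mu D)) => _ [n _ <-].
have [g Cg] := C_nonempty n.
by rewrite (le_trans (I_le Cg))//; case/andP: (N_le Cg).
Qed.

(* The accuracies q j are summable, and they decrease. *)
Let q (j : nat) : R := (2 ^ j.+1)%:R^-1.

Let q_gt0 j : 0 < q j.
Proof. by rewrite /q invr_gt0 ltr0n expn_gt0. Qed.

Let q_decr j : q j.+1 <= q j.
Proof. by rewrite /q lef_pV2 ?posrE ?ltr0n ?expn_gt0// ler_nat leq_exp2l. Qed.

Let minimizer j : exists p : nat * (T -> R),
  [/\ (j <= p.1)%N, C p.1 p.2, J - q j ^+ 2 <= I p.1 & N p.2 <= J + q j ^+ 2].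
Proof.
have q2 : 0 < q j ^+ 2 by rewrite exprn_gt0.
have [_ [m _ <-] mJ] := sup_adherent q2 hasJ.
have [_ [g Cg <-] gI] := inf_adherent q2 (hasI (maxn j m)).
have IJ : I (maxn j m) <= J by apply: ub_le_sup; [exact: hasJ.2|exists (maxn j m)].
exists (maxn j m, g); split => //=.
- exact: leq_maxl.
- by rewrite (le_trans (ltW mJ))// I_mono// leq_maxr.
- by rewrite (le_trans (ltW gI))// lerD2r.
Qed.

Lemma decreasing_convex_ae_cvg : exists h : nat -> T -> R,
  (forall j, C j (h j)) /\ {ae mu, forall t, D t -> cvgn (fun j => h j t)}.
Proof.
have [p Hp] := choice minimizer.
pose h j := (p j).2.
have Ch j : C (p j).1 (h j) by have [] := Hp j.
exists h; split.
  by move=> j; have [jm Cp _ _] := Hp j; exact: C_decreasing jm _ Cp.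
have mh j : measurable_fun D (h j) by exact: C_measurable (Ch j).
have hB j t : D t -> `|h j t| <= B by exact: C_bounded (Ch j).
(* Parallelogram identity: two almost minimizers are L2 close, since their midpoint
   belongs to the larger of the two sets. *)
pose De j t := h j.+1 t - h j t.
have mDe j : measurable_fun D (De j) by exact: measurable_funB.
have NDe j : N (De j) <= 8 * q j ^+ 2.
  have [jm Cp JI NJ] := Hp j; have [jm' Cp' JI' NJ'] := Hp j.+1.
  pose m := minn (p j).1 (p j.+1).1.
  have Cm : C m (h j) by apply: C_decreasing Cp; exact: geq_minl.
  have Cm' : C m (h j.+1) by apply: C_decreasing Cp'; exact: geq_minr.
  have Cmid := C_midpoint Cm' Cm.
  have qq : q j.+1 ^+ 2 <= q j ^+ 2 by rewrite ler_pXn2r ?nnegrE ?(ltW (q_gt0 _)).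
  have Im : J - q j ^+ 2 <= I m.
    by rewrite /m /minn; case: ifP => _ //; lra.
  have := I_le Cmid => NI.
  have -> : N (De j) = 2 * N (h j.+1) + 2 * N (h j)
      - 4 * N (fun t => (h j.+1 t + h j t) / 2).
    have iZ c g n : C n g -> mu.-integrable D (EFin \o (fun t => c * g t ^+ 2)).
      move=> Cg; have := integrableZl mD c (int_sq Cg).
      by apply: eq_integrable => // t _ /=; rewrite EFinM.
    have ZN c g n : C n g -> c * N g = \int[mu]_(t in D) (c * g t ^+ 2).
      by move=> Cg; rewrite RintegralZl//; exact: int_sq Cg.
    have iD := integrableD mD (iZ 2 _ _ Cm') (iZ 2 _ _ Cm).
    rewrite !(ZN _ _ _ Cm') !(ZN _ _ _ Cm) (ZN _ _ _ Cmid).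
    rewrite -RintegralD//; [|exact: (iZ _ _ _ Cm')|exact: (iZ _ _ _ Cm)].
    rewrite -RintegralB//; [|exact: (iZ _ _ _ Cmid)].
    by apply: eq_Rintegral => t _; rewrite /De; field.
  rewrite /h in NI *; lra.
(* As |x| <= q + x^2 / q, the L1 distances of consecutive terms are summable. *)
have intDe j : (\int[mu]_(t in D) `|De j t|%:E <= ((fine (mu D) + 8) / (2 ^ j.+1)%:R)%:E)%E.
  have q0 := q_gt0 j.
  have idom : mu.-integrable D (EFin \o (fun t => q j + (q j)^-1 * De j t ^+ 2)).
    apply: (@bint _ (q j + (q j)^-1 * (B + B) ^+ 2)).
      apply: measurable_funD => //; apply: measurable_funM => //.
      exact: measurable_funX.
    move=> t Dt; rewrite ger0_norm; last first.
      apply: addr_ge0; first exact: ltW.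
      by apply: mulr_ge0; [rewrite invr_ge0 ltW|exact: sqr_ge0].
    rewrite lerD2l ler_pM2l ?invr_gt0//.
    have := hB j t Dt; have := hB j.+1 t Dt; rewrite /De !ler_norml => /andP[? ?] /andP[? ?].
    nra.
  have iDe : mu.-integrable D (EFin \o (fun t => `|De j t|)).
    apply: (@bint _ (B + B)); first exact: measurableT_comp.
    move=> t Dt; rewrite normr_id (le_trans (ler_normB _ _))//.
    by rewrite lerD// hB.
  have iDe2 : mu.-integrable D (EFin \o (fun t => De j t ^+ 2)).
    apply: (@bint _ ((B + B) ^+ 2)); first exact: measurable_funX.
    move=> t Dt; rewrite ger0_norm ?sqr_ge0//.
    have := hB j t Dt; have := hB j.+1 t Dt; rewrite /De !ler_norml => /andP[? ?] /andP[? ?].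
    nra.
  rewrite -(fineK (integrable_fin_num _ iDe))// lee_fin -/(Rintegral _ _ _).
  apply: (@le_trans _ _ (\int[mu]_(t in D) (q j + (q j)^-1 * De j t ^+ 2))).
    apply: le_Rintegral => // t Dt.
    have := sqr_ge0 (q j - `|De j t|); rewrite -(real_normK (num_real (De j t))).
    rewrite -subr_ge0 => H.
    rewrite -(ler_pM2l q0) mulrDr mulVKf ?gt_eqF//; nra.
  have iq : mu.-integrable D (EFin \o (fun t : T => q j)).
    by apply: (@bint _ `|q j|) => //.
  have iq2 : mu.-integrable D (EFin \o (fun t => (q j)^-1 * De j t ^+ 2)).
    have := integrableZl mD (q j)^-1 iDe2.
    by apply: eq_integrable => // t _ /=; rewrite EFinM.
  rewrite RintegralD// Rintegral_cst// RintegralZl//.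
  rewrite -/(q j) mulrDl mulrC lerD2l.
  rewrite -(ler_pM2l q0) mulVKf ?gt_eqF//.
  by apply: (le_trans (NDe j)); rewrite expr2 mulrCA.
have int_sum : (\int[mu]_(t in D) (\sum_(0 <= j <oo) `|De j t|%:E) < +oo)%E.
  rewrite integral_nneseries//; last 1 first.
  - by move=> j; apply/measurable_EFinP; exact: measurableT_comp.
  have := @cvg_geometric_eseries_half R (fine (mu D) + 8) 0.
  move/cvg_lim => /(_ (@ereal_hausdorff R)) HG.
  apply: (@le_lt_trans _ _ ((fine (mu D) + 8) / 2 ^+ 0)%:E); last exact: ltry.
  rewrite -HG; apply: lee_nneseries => //.
    by move=> j _ _; exact: integral_ge0.
  by move=> j _; rewrite addn1; exact: intDe.
have mS : measurable_fun D (fun t => \sum_(0 <= j <oo) `|De j t|%:E)%E.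
  apply: ge0_emeasurable_sum => //.
  by move=> j _; apply/measurable_EFinP; exact: measurableT_comp.
have iS : mu.-integrable D (fun t => \sum_(0 <= j <oo) `|De j t|%:E)%E.
  apply/integrableP; split => //.
  rewrite (eq_integral (fun t => \sum_(0 <= j <oo) `|De j t|%:E)%E); first exact: int_sum.
  by move=> t _; rewrite gee0_abs//; exact: nneseries_ge0.
have := integrable_ae mD iS.
apply: filterS.
move=> t + Dt => /(_ Dt); rewrite ge0_fin_numE; last exact: nneseries_ge0.
move=> /(@nnseries_is_cvg _ _ (fun i => normr_ge0 _)) H.
have /(@normed_cvg _ _ (fun j => De j t)) /cvg_ex[l Hl] := H.
apply/cvg_ex; exists (h 0%N t + l).
have -> : (fun j => h j t) = (fun j => h 0%N t + series (fun j => De j t) j).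
  by apply/funext => j; rewrite (eq_sum_telescope (fun j => h j t)).
by apply: cvgD => //; exact: cvg_cst.
Qed.

End decreasing_convex_sets.

(** * Uniform cluster points of equi-Lipschitz sequences *)

(** A basic neighbourhood for the topology of pointwise convergence. *)
Lemma ptws_nbhs (R : realType) (t e : R) (k : prod_topology (fun _ : R => (R : topologicalType))) :
  0 < e -> nbhs k [set f | `|f t - k t| < e].
Proof.
move=> e0.
have -> : [set f | `|f t - k t| < e] =
  @proj R (fun _ => (R : topologicalType)) t @^-1` ball (k t) e.
  by apply/seteqP; split => f; rewrite /ball/= distrC.
exact: (@proj_continuous R (fun _ => (R : topologicalType)) t k _ (nbhsx_ballx (k t) e e0)).
Qed.

(** A cluster point for pointwise convergence, which exists by Tychonoff's theorem,
is uniformly approached along the sequence on [a, b], because it suffices to be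
close on a finite net. *)
Lemma equiLipschitz_cluster (R : realType) (a b m B L : R) (K : nat -> R -> R) :
  0 <= L ->
  (forall n t, m <= K n t <= B) ->
  (forall n s t, `|K n s - K n t| <= L * `|s - t|) ->
  exists k : R -> R, (forall s t, `|k s - k t| <= L * `|s - t|) /\
    forall (e : R) N, 0 < e -> exists2 n, (N <= n)%N &
      forall t, a <= t <= b -> `|K n t - k t| <= e.
Proof.
move=> L0 Kb KL.
have cpt := @tychonoff R (fun _ => R) (fun _ => `[m, B]%classic)
  (fun _ => @segment_compact R m B).
pose F : set_system (prod_topology (fun _ : R => (R : topologicalType))) := K @ \oo.
have FF : ProperFilter F by exact: fmap_proper_filter.
have [|k [_ kF]] := cpt F FF.
  by exists 0%N => // n _ t; rewrite /= in_itv/=; exact: Kb.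
have close n (s : 'I_n -> R) e N : 0 < e ->
    exists2 j, (N <= j)%N & forall i, `|K j (s i) - k (s i)| < e.
  move=> e0.
  have nb : nbhs (k : prod_topology (fun _ : R => (R : topologicalType)))
      [set f | forall i, `|f (s i) - k (s i)| < e].
    apply: (@filter_forall _ _ (fun (i : 'I_n) (f : R -> R) => `|f (s i) - k (s i)| < e)
      _ (nbhs_filter (k : prod_topology (fun _ : R => (R : topologicalType))))) => i.
    exact: ptws_nbhs.
  have FN : F (K @` [set j | (N <= j)%N]).
    by exists N => //= j /= Nj; exists j.
  by have [_ [[j /= Nj <-] /= H]] := kF _ _ FN nb; exists j.
have kL s t : `|k s - k t| <= L * `|s - t|.
 apply/ler_addgt0Pr => e e0.
  have e2 : 0 < e / 2 by lra.
  have [j _ H] := close 2 (fun i => if i == ord0 then s else t) _ 0%N e2.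
  have := H ord0; have := H ord_max; rewrite /= => Ht Hs.
  have -> : k s - k t = (K j s - K j t) - (K j s - k s) + (K j t - k t) by ring.
  apply: (le_trans (ler_normD _ _)).
  have := ler_normB (K j s - K j t) (K j s - k s).
  have := KL j s t; lra.
exists k; split => // e N e0.
(* Net of mesh de: between two points of the net both functions vary by at most e / 3. *)
pose de := e / (3 * (L + 1)).
have de0 : 0 < de by rewrite divr_gt0// mulr_gt0//; lra.
have Lde : L * de <= e / 3.
  have -> : e / 3 = (L + 1) * de by rewrite /de; field; lra.
  by rewrite ler_wpM2r//; lra.
pose n := (Num.truncn ((b - a) / de)).+1.
have e3 : 0 < e / 3 by lra.
have [j Nj H] := close n (fun i => a + (val i)%:R * de) _ N e3.
exists j => // t /andP[at_ tb].
pose i := Num.truncn ((t - a) / de).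
have ilt : (i < n)%N.
  by rewrite ltnS; apply: le_truncn; rewrite ler_pM2r ?invr_gt0//; lra.
have := H (Ordinal ilt); rewrite /=; set s := (a + _) => Hs.
have ta0 : 0 <= (t - a) / de by apply: divr_ge0; lra.
have ts : `|t - s| <= de.
  have /andP[] := truncn_itv ta0; rewrite -/i ler_pdivlMr// ltr_pdivrMr// => i1 i2.
  rewrite /s ger0_norm; last lra.
  by move: i2; rewrite -natr1 mulrDl; lra.
have -> : K j t - k t = (K j t - K j s) + (K j s - k s) + (k s - k t) by ring.
have := KL j t s.
have := kL s t; rewrite [`|s - t|]distrC.
have : L * `|t - s| <= L * de by rewrite ler_wpM2l.
have := ler_normD ((K j t - K j s) + (K j s - k s)) (k s - k t).
have := ler_normD (K j t - K j s) (K j s - k s).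
lra.
Qed.

(** * Lipschitz, absolutely continuous and uniformly continuous functions *)

(** Projection of the real line onto the interval [a, b], for a <= b. *)
Definition clamp (R : realType) (a b t : R) := Num.max a (Num.min t b).

Lemma clamp_itv (R : realType) (a b t : R) : a <= b -> a <= clamp a b t <= b.
Proof. by move=> ab; rewrite /clamp le_max lexx ge_max ab ge_min lexx orbT. Qed.

Lemma clamp_id (R : realType) (a b t : R) : a <= t <= b -> clamp a b t = t.
Proof. by move=> /andP[at_ tb]; rewrite /clamp min_l// max_r. Qed.

Lemma max_Lipschitz (R : realType) (a s t : R) :
  `|Num.max a s - Num.max a t| <= `|s - t|.
Proof.
rewrite ler_norml; have := ler_norm (s - t); have := ler_norm (- (s - t)).
by rewrite normrN; case: (leP a s) => ?; case: (leP a t) => ? ? ?;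
  apply/andP; split; lra.
Qed.

Lemma clamp_Lipschitz (R : realType) (a b s t : R) :
  `|clamp a b s - clamp a b t| <= `|s - t|.
Proof.
apply: (le_trans (max_Lipschitz _ _ _)).
rewrite ler_norml; have := ler_norm (s - t); have := ler_norm (- (s - t)).
by rewrite normrN; case: (leP s b) => ?; case: (leP t b) => ? ? ?;
  apply/andP; split; lra.
Qed.

(** Extending a function from [a, b] to the real line by constants preserves its
Lipschitz constant. *)
Lemma clamp_comp_Lipschitz (R : realType) (f : R -> R) (a b L : R) :
  a <= b -> 0 <= L ->
  (forall x y, a <= x -> x <= y -> y <= b -> `|f y - f x| <= L * (y - x)) ->
  forall s t, `|f (clamp a b s) - f (clamp a b t)| <= L * `|s - t|.
Proof.
move=> ab L0 fL s t.
apply: (@le_trans _ _ (L * `|clamp a b s - clamp a b t|)); last first.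
  by apply: ler_wpM2l => //; exact: clamp_Lipschitz.
move: (clamp_itv s ab) (clamp_itv t ab).
move: (clamp _ _ s) (clamp _ _ t) => {}s {}t /andP[as_ sb] /andP[at_ tb].
have [st|/ltW ts] := leP s t.
  by rewrite distrC [`|s - t|]distrC [`|t - s|]ger0_norm ?subr_ge0// fL.
by rewrite [`|s - t|]ger0_norm ?subr_ge0// fL.
Qed.

Lemma Lipschitz_continuous (R : realType) (f : R -> R) (L : R) :
  (forall s t, `|f s - f t| <= L * `|s - t|) -> continuous f.
Proof.
move=> fL x; apply/cvgrPdist_lt => e e0.
have L1 : 0 < `|L| + 1 by have := normr_ge0 L; lra.
apply/nbhs_ballP; exists (e / (`|L| + 1)) => /=; first exact: divr_gt0.
move=> y; rewrite /ball/= ltr_pdivlMr// => xy.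
apply: (le_lt_trans (fL x y)); apply: le_lt_trans xy.
rewrite mulrC ler_wpM2l//; have := ler_norm L; lra.
Qed.

Lemma Lipschitz_absolutely_continuous (R : realType) (a b L : R) (f : R -> R) :
  (forall s t, a <= s -> s <= t -> t <= b -> `|f t - f s| <= L * (t - s)) ->
  absolutely_continuous a b f.
Proof.
move=> fL e e0.
have L1 : 0 < `|L| + 1 by have := normr_ge0 L; lra.
exists (e / (`|L| + 1)); first exact: divr_gt0.
move=> n u v uv _; rewrite ltr_pdivlMr// => S.
apply: le_lt_trans S; rewrite mulr_suml; apply: ler_sum => i _.
have [/andP[au uvi] vb] := uv i.
apply: (le_trans (fL _ _ au uvi vb)).
rewrite mulrC ler_wpM2l ?subr_ge0//; have := ler_norm L; lra.
Qed.

(** Absolute continuity passes to a subinterval and to a function with smaller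
increments. *)
Lemma absolutely_continuous_le (R : realType) (a b c d : R) (f g : R -> R) :
  a <= c -> d <= b ->
  (forall s t, c <= s -> s <= t -> t <= d -> `|g t - g s| <= `|f t - f s|) ->
  absolutely_continuous a b f -> absolutely_continuous c d g.
Proof.
move=> ac db gf fac e /fac[de de0 H]; exists de => // n u v uv tI S.
apply: le_lt_trans (H n u v _ tI S).
  apply: ler_sum => i _; have [/andP[cu uvi] vd] := uv i.
  exact: gf.
by move=> i; have [/andP[cu ->] vd] := uv i; rewrite (le_trans ac cu) (le_trans vd db).
Qed.

Lemma absolutely_continuousB (R : realType) (a b : R) (f g : R -> R) :
  absolutely_continuous a b f -> absolutely_continuous a b g ->
  absolutely_continuous a b (fun t => f t - g t).
Proof.
move=> fac gac e e0; have e2 : 0 < e / 2 by lra.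
have [d d0 Hf] := fac _ e2; have [d' d'0 Hg] := gac _ e2.
exists (Num.min d d'); first by rewrite lt_min d0.
move=> n u v uv tI; rewrite lt_min => /andP[/(Hf n u v uv tI) ? /(Hg n u v uv tI) ?].
apply: (@le_lt_trans _ _ (\sum_(i < n) `|f (v i) - f (u i)| +
    \sum_(i < n) `|g (v i) - g (u i)|)); last lra.
rewrite -big_split/=; apply: ler_sum => i _.
apply: (le_trans _ (ler_normB _ _)).
by rewrite le_eqVlt; apply/orP; left; apply/eqP; congr `|_|; ring.
Qed.

(** A continuous function on the half-line, extended by its value at 0, is continuous. *)
Lemma max0_continuous (R : realType) (f : R -> R) :
  {within `[0, +oo[, continuous f} -> continuous (fun x : R => f (Num.max 0 x)).
Proof.
move=> /subspace_continuousP fc; rewrite /continuous_at => x.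
have mx : (`[0, +oo[%classic : set R) (Num.max 0 x).
  by rewrite /= in_itv/= le_max lexx.
have /cvgrPdist_lt H := fc _ mx.
apply/cvgrPdist_lt => e e0.
have /nbhs_ballP[d /= d0 Hd] := H e e0.
apply/nbhs_ballP; exists d => //= y; rewrite /ball/= => xy.
apply: Hd; last by rewrite /= in_itv/= le_max lexx.
rewrite /ball/=; apply: le_lt_trans xy.
exact: max_Lipschitz.
Qed.

Lemma uniformly_continuous_itv (R : realType) (f : R -> R) (a b e : R) :
  a <= b -> continuous f -> 0 < e ->
  exists2 d : R, 0 < d & forall x y, a <= x <= b -> a <= y <= b ->
    `|x - y| < d -> `|f x - f y| <= e.
Proof.
move=> ab fc e0.
pose P c := exists2 d : R, 0 < d & forall x y, a <= x <= c -> a <= y <= c ->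
    `|x - y| < d -> `|f x - f y| <= e.
apply: (@real_induction _ a b P) => //.
  exists 1 => // x y /andP[? ?] /andP[? ?] _.
  have -> : x = y by lra.
  by rewrite subrr normr0 ltW.
move=> t _; have e2 : 0 < e / 2 by lra.
have /cvgrPdist_lt/(_ _ e2)/nbhs_ballP[eta /= eta0 H] := fc t.
exists (eta / 2); first lra.
move=> c c' /andP[ac ct] /andP[tc' cb] tc c't [d d0 Hd].
exists (Num.min d (eta / 2)); first by rewrite lt_min d0; lra.
have near z : t - eta < z -> z < t + eta -> `|f t - f z| < e / 2.
  by move=> z1 z2; apply: H; rewrite /ball/= ltr_norml; apply/andP; split; lra.
move=> x y /andP[ax xc'] /andP[ay yc']; rewrite lt_min => /andP[xyd].
rewrite ltr_norml => /andP[xy1 xy2].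
have [/andP[xc yc]|xyc] := boolP ((x <= c) && (y <= c)).
  by apply: Hd => //; rewrite ?ax ?ay.
have ? : c < x \/ c < y.
  by move: xyc; rewrite negb_and -!ltNge => /orP.
have : `|f t - f x| < e / 2 by apply: near; lra.
have : `|f t - f y| < e / 2 by apply: near; lra.
rewrite !ltr_norml => /andP[? ?] /andP[? ?].
by rewrite ler_norml; apply/andP; split; lra.
Qed.

(** * Integral representation and dominated convergence on an interval *)

Lemma Rintegral_dominated_cvg (R : realType) (a b M : R) (f_ : nat -> R -> R)
    (f : R -> R) :
  (forall n, measurable_fun [set: R] (f_ n)) -> measurable_fun [set: R] f ->
  (forall n t, a <= t <= b -> `|f_ n t| <= M) ->
  {ae lebesgue R, forall t, a <= t <= b -> f_ n t @[n --> \oo] --> f t} ->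
  \int[lebesgue R]_(t in `[a, b]) f_ n t @[n --> \oo] -->
    \int[lebesgue R]_(t in `[a, b]) f t.
Proof.
move=> mf_ mf fM ff.
have iM : (lebesgue R).-integrable `[a, b] (EFin \o (fun=> M)).
  by apply: (@integrable_bounded_itv _ _ _ _ `|M|) => //; exact: measurable_cst.
have [||||| intf _ cvgf] := @dominated_convergence _ _ _ (lebesgue R) `[a, b]%classic
  (measurable_itv _) (fun n t => (f_ n t)%:E) (EFin \o f) (EFin \o (fun=> M)).
- by move=> n; apply/measurable_EFinP; exact: measurable_funTS (mf_ n).
- by apply/measurable_EFinP; exact: measurable_funTS.
- apply: filterS ff => t H /=; rewrite in_itv/= => /H.
  by move=> ?; apply: cvg_EFin => //; exact: nearW.
- exact: iM.
- by apply: aeW => t n /=; rewrite in_itv/= => /fM; rewrite lee_fin.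
apply: fine_cvg.
by rewrite fineK//; apply: integrable_fin_num intf.
Qed.

(** The almost everywhere derivative of a Lipschitz function has a Borel
representative bounded everywhere by the Lipschitz constant: the upper limit of
the difference quotients, clamped to [- L, L]. *)
Lemma Lipschitz_derivative_measurable (R : realType) (f : R -> R) (a b L : R) :
  (forall s t, `|f s - f t| <= L * `|s - t|) ->
  {ae lebesgue R, forall t, t \in `[a, b] -> exists d, is_derive t 1 f d} ->
  exists v : R -> R, [/\ measurable_fun [set: R] v, forall t, `|v t| <= L &
    {ae lebesgue R, forall t, t \in `[a, b] -> is_derive t 1 f (v t)}].
Proof.
move=> fL df.
have L0 : 0 <= L.
  by have := le_trans (normr_ge0 _) (fL 1 0); rewrite subr0 normr1 mulr1.
pose q m t := m.+1%:R * (f (t + m.+1%:R^-1) - f t).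
have qL m t : `|q m t| <= L.
  have m0 : (0 : R) < m.+1%:R by rewrite ltr0n.
  rewrite /q normrM gtr0_norm// mulrC -ler_pdivlMr//.
  apply: (le_trans (fL _ _)); rewrite addrAC subrr add0r gtr0_norm ?invr_gt0//.
have fc := Lipschitz_continuous fL.
have mf : measurable_fun [set: R] f by exact: continuous_measurable_fun.
have mq m : measurable_fun [set: R] (q m).
  apply: measurable_funM => //; apply: measurable_funB => //.
  by apply: measurableT_comp => //; exact: measurable_funD.
have mw : measurable_fun [set: R] (fun t => limn_sup (q ^~ t)).
  apply: measurable_fun_limn_sup => //.
    by move=> t _; exists L => _ [m _ <-]; exact: le_trans (ler_norm _) (qL m t).
  move=> t _; exists (- L) => _ [m _ <-].
  by have := qL m t; rewrite ler_norml => /andP[].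
exists (fun t => clamp (- L) L (limn_sup (q ^~ t))); split.
- apply: (measurableT_comp (f := clamp (- L) L)) => //.
  apply: continuous_measurable_fun.
  apply: (@Lipschitz_continuous _ _ 1) => s t.
  by rewrite mul1r; exact: clamp_Lipschitz.
- move=> t; rewrite ler_norml; apply: clamp_itv; lra.
apply: filterS df => t H /H[d dfd]; suff -> : clamp (- L) L (limn_sup (q ^~ t)) = d by [].
have qd : q n t @[n --> \oo] --> d.
  apply/cvgrPdist_le => e e0.
  have [eta eta0 Heta] := is_derive_expansion dfd e0.
  near=> m.
  have m0 : (0 : R) < m.+1%:R by rewrite ltr0n.
  have mi : (0 : R) < m.+1%:R^-1 by rewrite invr_gt0.
  have := Heta (t + m.+1%:R^-1); rewrite [t + _ - t]addrAC subrr add0r gtr0_norm//.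
  have me : m.+1%:R^-1 < eta by near: m; exact: near_infty_natSinv_lt (PosNum eta0).
  move=> /(_ me); rewrite -(ler_pM2l m0) mulrCA mulfV ?gt_eqF// mulr1.
  rewrite -{1}(gtr0_norm m0) -normrM mulrBr mulrCA mulfV ?gt_eqF// mulr1.
  by rewrite distrC.
rewrite (cvg_limn_inf_sup qd).2 clamp_id// -ler_norml.
apply: (cvgr_to_le (cvg_norm qd)).
by apply: nearW => m; exact: qL.
Unshelve. all: by end_near. Qed.

(** Fundamental theorem of calculus: f and the primitive of its derivative differ
by an absolutely continuous function with almost everywhere zero derivative. *)
Lemma absolutely_continuous_increment (R : realType) (f g : R -> R) (a b L : R) :
  absolutely_continuous a b f ->
  measurable_fun [set: R] g -> (forall t, `|g t| <= L) ->
  {ae lebesgue R, forall t, t \in `[a, b] -> is_derive t 1 f (g t)} ->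
  forall x, a <= x <= b -> f x - f a = \int[lebesgue R]_(t in `[a, x]) g t.
Proof.
move=> fac mg gL df x /andP[ax xb].
pose V y := \int[lebesgue R]_(t in `[a, y]) g t.
have Va : V a = 0 by rewrite /V set_itv1 Rintegral_set1.
have VL : forall s t, a <= s -> s <= t -> t <= x -> `|V t - V s| <= L * (t - s).
  by move=> s t as_ st tx; exact: primitive_Lipschitz.
have Vac := Lipschitz_absolutely_continuous VL.
have fax : absolutely_continuous a x f by exact: absolutely_continuous_le fac.
have dV := ae_derive_primitive a mg gL.
have d0 (h : R -> R) : (forall t : R, is_derive t 1 f (g t) -> is_derive t 1 V (g t) ->
      is_derive t 1 h 0) ->
    {ae lebesgue R, forall t, t \in `[a, x] -> exists2 d, is_derive t 1 h d & d <= 0}.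
  move=> H; apply: filterS3 df dV (ae_neq a) => t dft dVt ta; rewrite in_itv/= => /andP[at_ tx].
  exists 0 => //; apply: H.
    by apply: dft; rewrite in_itv/= at_ (le_trans tx).
  by apply: dVt; rewrite lt_neqAle eq_sym ta.
have H1 : (f x - V x) - (f a - V a) <= 0 * (x - a).
  apply: (@ae_derive_le_increment _ (fun t => f t - V t)) => //.
    exact: absolutely_continuousB.
  by apply: d0 => t dft dVt; rewrite -(subrr (g t)); exact: is_deriveB.
have H2 : (V x - f x) - (V a - f a) <= 0 * (x - a).
  apply: (@ae_derive_le_increment _ (fun t => V t - f t)) => //.
    exact: absolutely_continuousB.
  by apply: d0 => t dft dVt; rewrite -(subrr (g t)); exact: is_deriveB.
by rewrite -/(V x); lra.
Qed.

Lemma Rintegral_dist_le (R : realType) (f g : R -> R) (a b M e : R) : a <= b ->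
  measurable_fun [set: R] f -> measurable_fun [set: R] g ->
  (forall t, a <= t <= b -> `|f t| <= M) -> (forall t, a <= t <= b -> `|g t| <= M) ->
  (forall t, a <= t <= b -> `|f t - g t| <= e) ->
  `|\int[lebesgue R]_(t in `[a, b]) f t - \int[lebesgue R]_(t in `[a, b]) g t|
    <= e * (b - a).
Proof.
move=> ab mf mg fM gM fg.
rewrite -RintegralB//.
- apply: Rintegral_norm_le_itv => //; apply: measurable_funTS.
  exact: measurable_funB.
- by apply: (@integrable_bounded_itv _ _ _ _ M) => //; exact: measurable_funTS.
- by apply: (@integrable_bounded_itv _ _ _ _ M) => //; exact: measurable_funTS.
Qed.

Lemma Rintegral_midpoint (R : realType) (f g : R -> R) (a b M : R) :
  measurable_fun [set: R] f -> measurable_fun [set: R] g ->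
  (forall t, a <= t <= b -> `|f t| <= M) -> (forall t, a <= t <= b -> `|g t| <= M) ->
  \int[lebesgue R]_(t in `[a, b]) ((f t + g t) / 2) =
  (\int[lebesgue R]_(t in `[a, b]) f t + \int[lebesgue R]_(t in `[a, b]) g t) / 2.
Proof.
move=> mf mg fM gM.
have intf := integrable_bounded_itv (measurable_funTS mf) fM.
have intg := integrable_bounded_itv (measurable_funTS mg) gM.
rewrite RintegralZr//; first by rewrite RintegralD.
apply: (@integrable_bounded_itv _ _ _ _ (M + M)).
  by apply: measurable_funTS; exact: measurable_funD.
by move=> t tab; rewrite (le_trans (ler_normD _ _))// lerD ?fM ?gM.
Qed.

(** * Concave functions on the half-line *)

Lemma concave_halfline (R : realType) (f : R -> R) :
  concave_function `[0, +oo[ f ->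
  forall p x y, 0 <= p <= 1 -> 0 <= x -> 0 <= y ->
    p * f x + (1 - p) * f y <= f (p * x + (1 - p) * y).
Proof.
move=> fc p x y /andP[p0 p1] x0 y0.
have D z : 0 <= z -> z \in (`[0, +oo[%classic : set R).
  by move=> z0; rewrite inE/= in_itv/= z0.
exact: (fc (Itv01 p0 p1) x y (D x x0) (D y y0)).
Qed.

Lemma concave_linear_growth (R : realType) (f : R -> R) :
  concave_function `[0, +oo[ f -> (forall x, 0 <= x -> 0 <= f x) ->
  forall x, 0 <= x -> f x <= 2 * f 1 * (1 + x).
Proof.
move=> fc f0 x x0; have f1 := f0 1 ler01; have fx := f0 x x0.
(* If x >= 1 then 1 lies between 0 and x; otherwise it lies between x and 2. *)
have [x1|x1] := leP 1 x.
  have xp : 0 < x by lra.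
  have := @concave_halfline _ _ fc x^-1 x 0.
  rewrite invr_ge0 x0 invf_le1// x1 => /(_ isT isT (lexx _)).
  rewrite mulr0 addr0 mulVf ?gt_eqF// => H.
  have H0 : 0 <= (1 - x^-1) * f 0.
    by apply: mulr_ge0; [rewrite subr_ge0 invf_le1|exact: f0].
  have : x^-1 * f x <= f 1 by lra.
  rewrite -(ler_pM2l xp) mulVKf ?gt_eqF// => H1; nra.
pose p := (2 - x)^-1.
have x2 : 0 < 2 - x by lra.
have p1 : p <= 1 by rewrite invf_le1//; lra.
have p0 : 0 < p by rewrite invr_gt0.
have pE : p * (2 - x) = 1 by rewrite mulVf// gt_eqF.
have := @concave_halfline _ _ fc p x 2.
rewrite (ltW p0) p1 x0 ler0n => /(_ isT isT isT).
have -> : p * x + (1 - p) * 2 = 1 by nra.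
have := f0 2; nra.
Qed.

Lemma ln1p_Lipschitz (R : realType) (y z : R) : 0 <= y -> 0 <= z ->
  `|ln (1 + y) - ln (1 + z)| <= `|y - z|.
Proof.
wlog yz : y z / z <= y => [H y0 z0|].
  have [|/ltW] := leP z y; first by move=> ?; exact: H.
  by move=> ?; rewrite distrC [leRHS]distrC; exact: H.
move=> y0 z0; have z1 : 0 < 1 + z by lra.
have y1 : 0 < 1 + y by lra.
rewrite ger0_norm; last by rewrite subr_ge0 ler_ln ?posrE//; lra.
rewrite ger0_norm ?subr_ge0// -ln_div ?posrE//.
have -> : (1 + y) / (1 + z) = 1 + (y - z) / (1 + z) by field; lra.
have q0 : 0 <= (y - z) / (1 + z) by apply: divr_ge0; lra.
apply: (le_trans (le_ln1Dx _)); first by apply: lt_le_trans q0; lra.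
rewrite ler_pdivrMr//; nra.
Qed.

(** * A priori bounds and admissible pairs *)

Section growth.
Context {R : realType}.
Variables (F : R -> R -> R) (omega : R -> R) (t0 T lambda sigma k0 : R).
Hypotheses (F_production : production_function F)
    (t0_ge0 : 0 <= t0) (t0_lt_T : t0 < T)
    (lambda_ge0 : 0 <= lambda) (sigma_gt0 : 0 < sigma) (k0_gt0 : 0 < k0)
    (omega_continuous : {within `[0, +oo[, continuous omega})
    (omega_concave : concave_function `[0, +oo[ omega)
    (phi_continuous : {within `[0, +oo[, continuous (per_capita F)})
    (phi_concave : concave_function `[0, +oo[ (per_capita F)).

Local Notation phi := (per_capita F).
(* ph and om are phi and omega extended to the real line by their values at 0. *)
Let ph (x : R) := phi (Num.max 0 x).
Let om (x : R) := omega (Num.max 0 x).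

Let phE x : 0 <= x -> ph x = phi x. Proof. by move=> x0; rewrite /ph max_r. Qed.
Let omE x : 0 <= x -> om x = omega x. Proof. by move=> x0; rewrite /om max_r. Qed.

Let phi_ge0 x : 0 <= x -> 0 <= phi x.
Proof. by move=> x0; apply: F_production.1. Qed.

Let ph_ge0 x : 0 <= ph x.
Proof. by apply: phi_ge0; rewrite le_max lexx. Qed.

Let ph_cont : continuous ph. Proof. exact: max0_continuous. Qed.
Let om_cont : continuous om. Proof. exact: max0_continuous. Qed.

(* phi x <= A (1 + x); B bounds the states, Phi the outputs phi k, and L the
   derivatives of the states. *)
Let A := 2 * phi 1.
Let B := (1 + k0) * expR (A * (T - t0)).
Let Phi := A * (1 + B).
Let L := Phi + sigma * B.

Let A_ge0 : 0 <= A. Proof. by rewrite mulr_ge0// phi_ge0. Qed.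
Let B_ge : k0 <= B.
Proof.
have := expR_ge1Dx (A * (T - t0)).
have A0 : 0 <= A * (T - t0) by rewrite mulr_ge0// subr_ge0 ltW.
have k0p := k0_gt0.
rewrite /B; move: (expR _) => E HE; have E1 : 1 <= E by lra.
nra.
Qed.
Let B_gt0 : 0 < B. Proof. exact: lt_le_trans B_ge. Qed.
Let Phi_ge0 : 0 <= Phi. Proof. by rewrite mulr_ge0// addr_ge0// ltW. Qed.
Let L_ge0 : 0 <= L. Proof. by apply: addr_ge0 => //; apply: mulr_ge0; exact: ltW. Qed.

Let phi_le_Phi x : 0 <= x <= B -> phi x <= Phi.
Proof.
move=> /andP[x0 xB]; apply: (le_trans (concave_linear_growth phi_concave phi_ge0 x0)).
by rewrite -/A /Phi ler_wpM2l// lerD2l.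
Qed.

(** A state and an investment u = s phi(k), with the state equation in integrated
form.  In contrast with feasible processes, both functions matter on the whole real
line: u is Borel measurable there, and the bounds hold at every real number. *)
Record admissible (k u : R -> R) : Prop := Admissible {
  adm_Lipschitz : forall s t, `|k s - k t| <= L * `|s - t| ;
  adm_state : forall t, 0 <= k t <= B ;
  adm_measurable : measurable_fun [set: R] u ;
  adm_invest : forall t, 0 <= u t <= ph (k t) ;
  adm_motion : forall x, t0 <= x <= T ->
    k x = k0 + \int[lebesgue R]_(t in `[t0, x]) (u t - sigma * k t) }.

(* value is the objective expressed through the investment. *)
Let payoff (k u : R -> R) t := om (ph (k t) - u t) * expR (- lambda * t).

Let value (k u : R -> R) := \int[lebesgue R]_(t in `[t0, T]) payoff k u t.

Let measurable_payoff (k u : R -> R) : measurable_fun [set: R] k -> measurable_fun [set: R] u ->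
  measurable_fun [set: R] (payoff k u).
Proof.
move=> mk mu; apply: measurable_funM.
  apply: measurableT_comp; first exact: continuous_measurable_fun.
  apply: measurable_funB => //.
  by apply: measurableT_comp => //; exact: continuous_measurable_fun.
by apply: measurableT_comp => //; exact: measurable_funM.
Qed.

Section feasible.
Variables (k s : R -> R).
Hypothesis ks : feasible_process F omega t0 T lambda sigma k0 k s.

Let k_ge0 t : t0 <= t <= T -> 0 <= k t.
Proof. by move=> H; apply: (state_ge0 ks); rewrite in_itv/=. Qed.

Let ae_state : {ae lebesgue R, forall t, t0 <= t <= T ->
  is_derive t 1 k (s t * phi (k t) - sigma * k t) /\ 0 <= s t <= 1}.
Proof.
have /completed_aeP H1 := state_equation ks.
have /completed_aeP H2 := control_bounds ks.
apply: filterS2 H1 H2 => t H1 H2 tD.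
by split; [apply: H1|apply: H2]; rewrite in_itv/=.
Qed.

(** Gronwall's inequality, in the form (ln (1 + k))' <= A. *)
Let state_le x : t0 <= x <= T -> k x <= B.
Proof.
move=> /andP[tx xT].
have : ln (1 + k x) - ln (1 + k t0) <= A * (x - t0).
  apply: (@ae_derive_le_increment _ (fun t => ln (1 + k t))) => //.
    apply: (absolutely_continuous_le _ _ _ (state_ac ks)) => //.
    move=> u v tu uv vx; apply: ln1p_Lipschitz; apply: k_ge0; apply/andP; split; lra.
  apply: filterS ae_state => t H; rewrite in_itv/= => /andP[tt tlex].
  have tD : t0 <= t <= T by rewrite tt (le_trans tlex).
  have [dk /andP[s0 s1]] := H tD.
  have kt := k_ge0 tD; have k1 : 0 < 1 + k t by lra.
  exists ((1 + k t)^-1 * (0 + (s t * phi (k t) - sigma * k t))).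
    have d1 : is_derive t 1 (fun t => 1 + k t) (0 + (s t * phi (k t) - sigma * k t)).
      exact: is_deriveD.
    exact: (@is_derive1_comp _ _ (fun t => 1 + k t) _ _ _ (is_derive1_ln k1) d1).
  rewrite add0r mulrC ler_pdivrMr//.
  have := concave_linear_growth phi_concave phi_ge0 kt; rewrite -/A => HA.
  have A0 := A_ge0.
  have := phi_ge0 kt => p0.
  have : 0 <= sigma * k t by apply: mulr_ge0 => //; exact: ltW.
  nra.
rewrite (state_initial ks) lerBlDr => H.
have kx : 0 <= k x by apply: k_ge0; rewrite tx.
have : 1 + k x <= B; last by lra.
have k1 : 0 < 1 + k0 by rewrite addr_gt0.
rewrite -[leLHS]lnK ?posrE; last by lra.
rewrite /B -{1}(lnK (x := 1 + k0)) ?posrE// -expRD ler_expR.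
apply: (le_trans H); rewrite addrC lerD2l ler_wpM2l//; lra.
Qed.


Let state_Lipschitz x y : t0 <= x -> x <= y -> y <= T -> `|k y - k x| <= L * (y - x).
Proof.
move=> tx xy yT.
have kac (c : R) : `|c| = 1 -> absolutely_continuous x y (fun t => c * k t).
  move=> c1; apply: (absolutely_continuous_le _ _ _ (state_ac ks)) => //.
  by move=> u v _ _ _; rewrite -mulrBr normrM c1 mul1r.
have dk (c : R) : `|c| = 1 -> {ae lebesgue R, forall t, t \in `[x, y] ->
    exists2 d, is_derive t 1 (fun t => c * k t) d & d <= L}.
  move=> c1; apply: filterS ae_state => t H; rewrite in_itv/= => /andP[xt ty].
  have tD : t0 <= t <= T by rewrite (le_trans tx xt) (le_trans ty yT).
  have [dk /andP[s0 s1]] := H tD.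
  exists (c * (s t * phi (k t) - sigma * k t)).
    exact: is_deriveZ.
  apply: (le_trans (ler_norm _)); rewrite normrM c1 mul1r.
  have k0t := k_ge0 tD; have kB := state_le tD.
  have p0 := phi_ge0 k0t.
  have pP : phi (k t) <= Phi by apply: phi_le_Phi; rewrite k0t.
  apply: (le_trans (ler_normB _ _)); apply: lerD.
    by rewrite ger0_norm ?mulr_ge0//; nra.
  have sg := ltW sigma_gt0.
  by rewrite ger0_norm ?mulr_ge0// ler_wpM2l.
rewrite ler_norml.
have := ae_derive_le_increment xy L_ge0 (kac 1 (normr1 _)) (dk 1 (normr1 _)).
have := ae_derive_le_increment xy L_ge0 (kac (-1) (normrN1 _)) (dk (-1) (normrN1 _)).
by rewrite !mul1r !mulN1r => ? ?; apply/andP; split; lra.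
Qed.

(* kh extends the state to the real line by constants. *)
Let kh t := k (clamp t0 T t).

Let cD t : t0 <= clamp t0 T t <= T. Proof. exact: clamp_itv (ltW _). Qed.

Let khE t : t0 <= t <= T -> kh t = k t. Proof. by move=> tD; rewrite /kh clamp_id. Qed.

Let kh_Lipschitz x y : `|kh x - kh y| <= L * `|x - y|.
Proof. exact: clamp_comp_Lipschitz (ltW _) _ state_Lipschitz x y. Qed.

Let ae_state_kh : {ae lebesgue R, forall t, t0 <= t <= T ->
  is_derive t 1 kh (s t * phi (kh t) - sigma * kh t) /\ 0 <= s t <= 1}.
Proof.
apply: filterS3 ae_state (ae_neq t0) (ae_neq T) => t H tt0 tT tD.
have [dk st] := H tD; split => //; rewrite khE//.
apply: near_eq_is_derive dk.
have : t \in `]t0, T[.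
  by move: tD => /andP[? ?]; rewrite in_itv/= !lt_neqAle [t0 == t]eq_sym tt0 tT; apply/andP.
move=> /near_in_itvoo; apply: filterS => z; rewrite in_itv/= => /andP[z0 zT].
by rewrite khE// !ltW.
Qed.

(** The investment s phi(k) is only Lebesgue measurable; it is replaced by the Borel
function kh' + sigma kh, which agrees with it almost everywhere, clamped so that
the constraint holds everywhere. *)
Lemma feasible_admissible : exists k1 u1, admissible k1 u1 /\
  objective F omega t0 T lambda k s = value k1 u1.
Proof.
have [|v [mv vL dv]] := Lipschitz_derivative_measurable (a := t0) (b := T) kh_Lipschitz.
  apply: filterS ae_state_kh => t H; rewrite in_itv/= => tD.
  by have [d _] := H tD; exists (s t * phi (kh t) - sigma * kh t).
have mkh : measurable_fun [set: R] kh.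
  by apply: continuous_measurable_fun; exact: Lipschitz_continuous kh_Lipschitz.
have khB t : 0 <= kh t <= B.
  by rewrite /kh k_ge0 ?state_le.
have mph : measurable_fun [set: R] (fun t => ph (kh t)).
  by apply: measurableT_comp => //; exact: continuous_measurable_fun.
pose u t := clamp 0 (ph (kh t)) (v t + sigma * kh t).
have mu : measurable_fun [set: R] u.
  apply: (@measurable_maxr _ _ _ _ (cst 0) _) => //.
  apply: (@measurable_minr _ _ _ _ (fun t => v t + sigma * kh t)) => //.
  by apply: measurable_funD => //; exact: measurable_funM.
have aeu : {ae lebesgue R, forall t, t0 <= t <= T ->
    [/\ u t = v t + sigma * kh t, u t = s t * phi (kh t) & 0 <= s t <= 1]}.
  apply: filterS2 ae_state_kh dv => t H1 H2 tD.
  have [d1 s01] := H1 tD.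
  have d2 : is_derive t 1 kh (v t) by apply: H2; rewrite in_itv/=.
  have vE : v t = s t * phi (kh t) - sigma * kh t.
    by rewrite -(derive_val (is_derive := d1)) -(derive_val (is_derive := d2)).
  have /andP[kh0 _] := khB t; have p0 := phi_ge0 kh0.
  have uE : u t = s t * phi (kh t).
    rewrite /u vE subrK clamp_id// phE//.
    move: s01 => /andP[s0 s1]; rewrite mulr_ge0//=.
    by rewrite ler_piMl.
  by split => //; rewrite uE vE subrK.
exists kh, u; split; first split => //.
- move=> t; exact: clamp_itv.
- move=> x xD.
  have khac : absolutely_continuous t0 T kh.
    apply: (@Lipschitz_absolutely_continuous _ _ _ L) => x' y' _ xy' _.
    by rewrite -[y' - x']ger0_norm ?subr_ge0.
  have := absolutely_continuous_increment khac mv vL dv xD.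
  rewrite [kh t0]khE ?lexx ?ltW// (state_initial ks) => /eqP.
  rewrite subr_eq addrC => /eqP ->; congr (_ + _).
  congr fine; apply: ae_eq_integral => //.
  + by apply/measurable_EFinP; exact: measurable_funTS.
  + apply/measurable_EFinP; apply: measurable_funTS.
    by apply: measurable_funB => //; exact: measurable_funM.
  + apply: filterS aeu => t H /=; rewrite in_itv/= => /andP[tt tx].
    have [|-> _ _] := H; last by rewrite addrK.
    by rewrite tt (le_trans tx)//; case/andP: xD.
rewrite /objective /value.
have mD : measurable (`[t0, T]%classic : set (lebesgueType R)).
  by apply: measurable_completed; exact: measurable_itv.
have mpay := measurable_payoff mkh mu.
have cpay : measurable_fun (`[t0, T]%classic : set (lebesgueType R))
    (EFin \o payoff kh u : lebesgueType R -> \bar R).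
  apply: measurable_fun_completed => //.
  by apply/measurable_EFinP; exact: measurable_funTS.
have aepay : ae_eq (clebesgue R) (`[t0, T]%classic : set (lebesgueType R))
    (EFin \o integrand F omega lambda k s)
    (EFin \o payoff kh u).
  apply/completed_aeP; apply: filterS aeu => t H /=; rewrite in_itv/= => tD.
  have [_ uE /andP[s0 s1]] := H tD.
  have /andP[kh0 _] := khB t.
  rewrite /integrand /payoff uE phE// -(khE tD) mulrBl mul1r omE//.
  by rewrite subr_ge0 ler_piMl// phi_ge0.
have ifeas := integrand_integrable ks.
have mint : measurable_fun (`[t0, T]%classic : set (lebesgueType R))
   (EFin \o integrand F omega lambda k s : lebesgueType R -> \bar R).
  by move/integrableP : ifeas => [].
have ipay : (clebesgue R).-integrable `[t0, T] (EFin \o payoff kh u).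
  exact: (ae_eq_integrable mD mint cpay aepay ifeas).
rewrite /Rintegral; congr fine.
transitivity (\int[clebesgue R]_(t in `[t0, T]) (payoff kh u t)%:E)%E.
  exact: (@ae_eq_integral _ _ _ (clebesgue R) _ _ _ mD mint cpay aepay).
apply: completed_integral ipay => //.
exact/measurable_EFinP.
Qed.

End feasible.
Let payoff_bound : exists W : R, forall (k u : R -> R) (t : R), (forall t, 0 <= k t <= B) ->
  (forall t, 0 <= u t <= ph (k t)) -> t0 <= t <= T -> `|payoff k u t| <= W.
Proof.
have [|c _ Hc] := @EVT_max R (fun x => `|om x|) 0 Phi Phi_ge0.
  apply: continuous_subspaceT => x.
  by apply: cvg_norm; exact: om_cont.
exists `|om c| => k u t kB uk /andP[tt _].
rewrite /payoff normrM; apply: (@le_trans _ _ (`|om c| * 1)); last by rewrite mulr1.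
apply: ler_pM => //.
  apply: Hc; rewrite in_itv/=; have /andP[u0 up] := uk t; have /andP[k0t kBt] := kB t.
  have : ph (k t) <= Phi by rewrite phE// phi_le_Phi.
  by move=> ?; apply/andP; split; lra.
rewrite ger0_norm ?expR_ge0// -expR0 ler_expR mulNr oppr_le0 mulr_ge0//.
exact: le_trans t0_ge0 tt.
Qed.

Let motion_bound (k u : R -> R) : (forall t, 0 <= k t <= B) ->
  (forall t, 0 <= u t <= ph (k t)) -> forall t, `|u t - sigma * k t| <= L.
Proof.
move=> kB uk t; have /andP[u0 up] := uk t; have /andP[k0t kBt] := kB t.
have pP : ph (k t) <= Phi by rewrite phE// phi_le_Phi.
have sg := ltW sigma_gt0.
apply: (le_trans (ler_normB _ _)); apply: lerD.
  by rewrite ger0_norm// (le_trans up).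
by rewrite ger0_norm ?mulr_ge0// ler_wpM2l.
Qed.

(** The control is s = u / phi(k); where phi(k) = 0, also u = 0, and s = 0 by the
convention on division by zero. *)
Lemma admissible_feasible k u : admissible k u ->
  exists s, feasible_process F omega t0 T lambda sigma k0 k s /\
    objective F omega t0 T lambda k s = value k u.
Proof.
move=> [kL kB mu uk kmot].
have mk : measurable_fun [set: R] k.
  by apply: continuous_measurable_fun; exact: Lipschitz_continuous kL.
have kge0 t : 0 <= k t by have /andP[] := kB t.
pose s t := u t / ph (k t).
have sphi t : s t * phi (k t) = u t.
  rewrite /s phE//; have [p0|p0] := eqVneq (phi (k t)) 0; last by rewrite divfK.
  by have := uk t; rewrite phE// p0 mulr0 => /le_anti.
have s01 t : 0 <= s t <= 1.
  have /andP[u0 up] := uk t; apply/andP; split; first exact: divr_ge0.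
  have [p0|p0] := eqVneq (ph (k t)) 0; first by rewrite /s p0 invr0 mulr0.
  by rewrite ler_pdivrMr ?mul1r// lt_neqAle eq_sym p0 ph_ge0.
have ms : measurable_fun [set: R] s.
  apply: measurable_funM => //.
  apply: (eq_measurable_fun (fun t => ph (k t) `^ (-1))).
    by move=> t _; rewrite powR_inv1.
  apply: (measurableT_comp (measurable_powR _)).
  by apply: measurableT_comp => //; exact: continuous_measurable_fun.
have kint t : integrand F omega lambda k s t = payoff k u t.
  rewrite /integrand /payoff mulrBl mul1r sphi -[phi (k t)]phE// omE//.
  by rewrite subr_ge0; have /andP[] := uk t.
have [W HW] := payoff_bound.
have mpay := measurable_payoff mk mu.
have mD : measurable (`[t0, T]%classic : set (lebesgueType R)).
  by apply: measurable_completed; exact: measurable_itv.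
have ipay : (clebesgue R).-integrable (`[t0, T]%classic : set (lebesgueType R))
    (EFin \o payoff k u).
  apply: (@measurable_bounded_integrable _ _ _ (clebesgue R)) => //.
  - have : (lebesgue R `[t0, T] < +oo)%E.
      by rewrite lebesgue_measure_itv/=; case: ifPn => // _; rewrite -EFinB ltry.
    exact.
  - by apply: measurable_fun_completed => //; exact: measurable_funTS.
  - exists W; split; first exact: num_real.
    move=> M WM t /=; rewrite in_itv/= => tD.
    exact: (le_trans (HW _ _ _ kB uk tD) (ltW WM)).
have kintE : integrand F omega lambda k s = payoff k u by apply/funext.
exists s; split; last first.
  rewrite /objective /value /Rintegral kintE; congr fine.
  by apply: completed_integral ipay => //; exact/measurable_EFinP.
split => //.
- apply: (@Lipschitz_absolutely_continuous _ _ _ L) => x y _ xy _.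
  by rewrite -[y - x]ger0_norm ?subr_ge0.
- by apply: measurable_fun_completed => //; exact: measurable_funTS.
- apply/completed_aeP.
  have mg : measurable_fun [set: R] (fun t => u t - sigma * k t).
    by apply: measurable_funB => //; exact: measurable_funM.
  have dV := ae_derive_primitive t0 mg (motion_bound kB uk).
  apply: filterS3 dV (ae_neq t0) (ae_neq T) => t H tt0 tT; rewrite in_itv/= => /andP[t0t tleT].
  have ltt : t0 < t by rewrite lt_neqAle eq_sym tt0.
  have dk := is_deriveD (is_derive_cst k0 t 1) (H ltt).
  rewrite sphi -[_ - _]add0r.
  apply: near_eq_is_derive dk.
  have : t \in `]t0, T[ by rewrite in_itv/= ltt lt_neqAle tT.
  move=> /near_in_itvoo; apply: filterS => z; rewrite in_itv/= => /andP[z0 zT].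
  by rewrite [RHS]kmot// !ltW.
- by rewrite kmot ?lexx ?ltW// set_itv1 Rintegral_set1 addr0.
- exact: aeW.
- by rewrite kintE.
Qed.

(** Without investment, k(t) = k0 e^(- sigma (t - t0)). *)
Let admissible_exists : exists k u, admissible k u.
Proof.
pose f t : R := k0 * expR (- sigma * (t - t0)).
have f_ge0 t : 0 <= f t by rewrite mulr_ge0 ?expR_ge0// ltW.
have f_le t : t0 <= t -> f t <= k0.
  move=> tt; rewrite /f ler_piMr ?(ltW k0_gt0)// -expR0 ler_expR mulNr oppr_le0.
  by rewrite mulr_ge0 ?subr_ge0// ltW.
have fL x y : t0 <= x -> x <= y -> y <= T -> `|f y - f x| <= L * (y - x).
  move=> tx xy _; have fx := f_le x tx; have fx0 := f_ge0 x.
  have -> : f y = f x * expR (- sigma * (y - x)).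
    by rewrite /f -mulrA -expRD; congr (_ * expR _); ring.
  have e1 : 1 - sigma * (y - x) <= expR (- sigma * (y - x)).
    by rewrite -mulNr expR_ge1Dx.
  have s0 : 0 <= sigma * (y - x) by rewrite mulr_ge0 ?subr_ge0// ltW.
  have e2 : expR (- sigma * (y - x)) <= 1 by rewrite -expR0 ler_expR mulNr oppr_le0.
  move: (expR _) e1 e2 => E e1 e2.
  rewrite distrC ger0_norm; last by rewrite subr_ge0 ler_piMr.
  have kB := B_ge; have P0 := Phi_ge0; have sg := sigma_gt0.
  have : L * (y - x) = Phi * (y - x) + B * (sigma * (y - x)) by rewrite /L; ring.
  have : 0 <= Phi * (y - x) by rewrite mulr_ge0// subr_ge0.
  move: (sigma * (y - x)) s0 e1 => S s0 e1; move: (Phi * _) (L * _) => p l p0 ->.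
  have : f x * S <= B * S by rewrite ler_wpM2r// (le_trans fx).
  have : f x - f x * E <= f x * S by rewrite -{1}[f x]mulr1 -mulrBr ler_wpM2l//; lra.
  lra.
have cD t : t0 <= clamp t0 T t <= T by exact: clamp_itv (ltW _).
pose k t := f (clamp t0 T t).
have kL s t : `|k s - k t| <= L * `|s - t|.
  exact: clamp_comp_Lipschitz (ltW _) _ fL s t.
have kB t : 0 <= k t <= B.
  have /andP[tc _] := cD t.
  by rewrite /k f_ge0 (le_trans (f_le _ tc)).
have mk : measurable_fun [set: R] k.
  by apply: continuous_measurable_fun; exact: Lipschitz_continuous kL.
exists k, (fun=> 0); split => //; first by move=> t; rewrite lexx ph_ge0.
move=> x xD.
have mg : measurable_fun [set: R] (fun t => 0 - sigma * k t).
  by apply: measurable_funB => //; exact: measurable_funM.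
have gL := motion_bound kB (u := fun=> 0) _.
have := @absolutely_continuous_increment _ f (fun t => 0 - sigma * k t) t0 T L
  (Lipschitz_absolutely_continuous fL) mg (gL _) _ x xD.
have -> : f t0 = k0 by rewrite /f subrr mulr0 expR0 mulr1.
rewrite /k [clamp t0 T x]clamp_id// => H.
apply/eqP; rewrite -subr_eq0 opprD addrA subr_eq0; apply/eqP; apply: H.
  by move=> t; rewrite lexx ph_ge0.
apply: aeW => t; rewrite in_itv/= => tD.
rewrite clamp_id// sub0r /f.
have dl : is_derive t 1 (fun t => - sigma * (t - t0)) (- sigma * (1 - 0)).
  by apply: is_deriveZ; exact: is_deriveB.
have := is_deriveZ k0 (@is_derive1_comp _ expR _ t _ _ (is_derive_expR _) dl).
congr (is_derive _ _ _ _); rewrite /GRing.scale/=; ring.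
Qed.

(** * Existence of an optimal admissible pair *)

(** The investments which satisfy the constraint for the state k, the integrated
state equation up to an error e, and reach the value M up to e. *)
Definition near_optimal (k : R -> R) (M e : R) : set (R -> R) :=
  [set g : R -> R | [/\ measurable_fun [set: R] g, (forall t, 0 <= g t <= ph (k t)),
    (forall x, t0 <= x <= T ->
      `|k x - (k0 + \int[lebesgue R]_(t in `[t0, x]) (g t - sigma * k t))| <= e) &
    M - e <= value k g]].

Section limit_state.
Variables (k : R -> R) (M : R).
Hypothesis kL : forall s t : R, `|k s - k t| <= L * `|s - t|.
Hypothesis kB : forall t : R, 0 <= k t <= B.

Let mk : measurable_fun [set: R] k.
Proof. by apply: continuous_measurable_fun; exact: Lipschitz_continuous kL. Qed.

Let phB t : 0 <= ph (k t) <= Phi.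
Proof. by have /andP[? ?] := kB t; rewrite ph_ge0 phE// phi_le_Phi. Qed.

Let mph : measurable_fun [set: R] (fun t => ph (k t)).
Proof. by apply: measurableT_comp => //; exact: continuous_measurable_fun. Qed.

Let measurable_motion (g : R -> R) : measurable_fun [set: R] g ->
  measurable_fun [set: R] (fun t => g t - sigma * k t).
Proof. by move=> mg; apply: measurable_funB => //; exact: measurable_funM. Qed.

(** If k is a uniform limit of states of admissible pairs (k1, u1) with values
close to M, then min(u1, phi(k)) is near optimal for k. *)
Lemma near_optimal_nonempty (e : R) : 0 < e ->
  (forall d : R, 0 < d -> exists k1 u1, [/\ admissible k1 u1, M - d <= value k1 u1 &
    forall t, t0 <= t <= T -> `|k1 t - k t| <= d]) ->
  near_optimal k M e !=set0.
Proof.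
move=> e0 approx.
have tT : 0 < T - t0 by rewrite subr_gt0.
pose tau := T - t0 + 1.
have tau0 : 0 < tau by rewrite addr_gt0.
(* e / (2 tau) is the modulus wanted for omega, eta the one wanted for phi, and de
   the distance wanted between the states k1 and k. *)
have e1 : 0 < e / (2 * tau) by rewrite divr_gt0// mulr_gt0.
have [d1 d10 Hom] := uniformly_continuous_itv Phi_ge0 om_cont e1.
pose eta := Num.min (d1 / 3) (e / (4 * tau)).
have eta0 : 0 < eta by rewrite lt_min !divr_gt0// mulr_gt0.
have [d2 d20 Hph] := uniformly_continuous_itv (ltW B_gt0) ph_cont eta0.
have sg := ltW sigma_gt0.
have st0 : 0 < 1 + sigma * tau.
  have : 0 <= sigma * tau by rewrite mulr_ge0// ltW.
  lra.
pose de := Num.min (e / 2) (Num.min (d2 / 2) (e / (4 * (1 + sigma * tau)))).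
have de0 : 0 < de.
  by rewrite !lt_min; apply/and3P; split; rewrite divr_gt0// mulr_gt0.
have [k1 [u1 [[k1L k1B mu1 u1k k1mot] val1 k1k]]] := approx de de0.
have de_e : de <= e / 2 by rewrite /de ge_min lexx.
have de_d2 : de < d2.
  by apply: (@le_lt_trans _ _ (d2 / 2)); [rewrite /de !ge_min lexx orbT|lra].
have de_st : de * (1 + sigma * tau) <= e / 4.
  have -> : e / 4 = e / (4 * (1 + sigma * tau)) * (1 + sigma * tau).
    by field; rewrite gt_eqF.
  by apply: ler_wpM2r; [exact: ltW|rewrite /de !ge_min lexx !orbT].
have eta_d1 : eta + eta < d1.
  have : eta <= d1 / 3 by rewrite /eta ge_min lexx.
  lra.
have eta_tau : eta * tau <= e / 4.
  have -> : e / 4 = e / (4 * tau) * tau by field; rewrite gt_eqF.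
  by apply: ler_wpM2r; [exact: ltW|rewrite /eta ge_min lexx orbT].
have mk1 : measurable_fun [set: R] k1.
  by apply: continuous_measurable_fun; exact: Lipschitz_continuous k1L.
have phk t : t0 <= t <= T -> `|ph (k1 t) - ph (k t)| <= eta.
  by move=> tD; apply: Hph => //; apply: le_lt_trans de_d2; exact: k1k.
pose g t := Num.min (u1 t) (ph (k t)).
have mg : measurable_fun [set: R] g by exact: measurable_minr.
have gk t : 0 <= g t <= ph (k t).
  have /andP[u0 _] := u1k t; have /andP[p0 _] := phB t.
  by rewrite /g le_min u0 p0 ge_min lexx orbT.
have gu t : t0 <= t <= T -> `|g t - u1 t| <= eta.
  move=> /phk; have /andP[_ up] := u1k t; rewrite /g.
  case: (leP (u1 t) (ph (k t))) => pu; first by rewrite subrr normr0 => _; exact: ltW.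
  rewrite ler_norml => /andP[h1 h2].
  by rewrite ler_norml; apply/andP; split; lra.
exists g; split => //.
- move=> x /andP[tx xT].
  have xD t : t0 <= t <= x -> t0 <= t <= T.
    by move=> /andP[-> tlex]; rewrite (le_trans tlex).
  have -> : k x - (k0 + \int[lebesgue R]_(t in `[t0, x]) (g t - sigma * k t)) =
     (k x - k1 x) + (\int[lebesgue R]_(t in `[t0, x]) (u1 t - sigma * k1 t) -
        \int[lebesgue R]_(t in `[t0, x]) (g t - sigma * k t)).
    by rewrite (k1mot x) ?tx//; ring.
  apply: (le_trans (ler_normD _ _)).
  have kx : `|k x - k1 x| <= de by rewrite distrC k1k// tx.
  have : `|\int[lebesgue R]_(t in `[t0, x]) (u1 t - sigma * k1 t) -
      \int[lebesgue R]_(t in `[t0, x]) (g t - sigma * k t)| <= (eta + sigma * de) * (x - t0).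
    apply: (@Rintegral_dist_le _ _ _ _ _ L) => //.
    + by apply: measurable_funB => //; exact: measurable_funM.
    + exact: measurable_motion.
    + by move=> t _; exact: motion_bound.
    + by move=> t _; exact: motion_bound.
    + move=> t /xD tD; have := gu t tD; have := k1k t tD => H1 H2.
      have -> : u1 t - sigma * k1 t - (g t - sigma * k t) =
        - (g t - u1 t) - sigma * (k1 t - k t) by ring.
      apply: (le_trans (ler_normB _ _)); rewrite normrN lerD//.
      by rewrite normrM (ger0_norm sg) ler_wpM2l.
  have xt : x - t0 <= tau by rewrite /tau; lra.
  have q0 : 0 <= eta + sigma * de by rewrite addr_ge0 ?mulr_ge0// ltW.
  have : (eta + sigma * de) * (x - t0) <= (eta + sigma * de) * tau by rewrite ler_wpM2l.
  have -> : (eta + sigma * de) * tau = eta * tau + sigma * tau * de by ring.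
  have : de * (1 + sigma * tau) = de + sigma * tau * de by ring.
  lra.
- have [W HW] := payoff_bound.
  have H : `|value k g - value k1 u1| <= e / (2 * tau) * (T - t0).
    apply: (@Rintegral_dist_le _ _ _ _ _ W); first exact: ltW.
    + exact: measurable_payoff.
    + exact: measurable_payoff.
    + by move=> t; exact: HW.
    + by move=> t; exact: HW.
    + move=> t tD; rewrite /payoff -mulrBl normrM.
      have ex1 : `|expR (- lambda * t)| <= 1.
        rewrite ger0_norm ?expR_ge0// -expR0 ler_expR mulNr oppr_le0 mulr_ge0//.
        by have /andP[tt _] := tD; exact: le_trans tt.
      apply: (@le_trans _ _ (e / (2 * tau) * 1)); last by rewrite mulr1.
      apply: ler_pM => //.
      have /andP[g0 gp] := gk t; have /andP[p0 pP] := phB t.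
      have /andP[u0 up] := u1k t; have /andP[k10 k1B'] := k1B t.
      have pP1 : ph (k1 t) <= Phi by rewrite phE// phi_le_Phi// k10.
      apply: Hom.
      * by rewrite subr_ge0 gp (le_trans _ pP)// gerBl.
      * by rewrite subr_ge0 up (le_trans _ pP1)// gerBl.
      have -> : ph (k t) - g t - (ph (k1 t) - u1 t) =
          - (ph (k1 t) - ph (k t)) - (g t - u1 t) by ring.
      apply: le_lt_trans eta_d1; apply: (le_trans (ler_normB _ _)).
      by rewrite normrN lerD// ?phk ?gu.
  have : e / (2 * tau) * (T - t0) <= e / 2.
    have -> : e / 2 = e / (2 * tau) * tau by field; rewrite gt_eqF.
    by apply: ler_wpM2l; [exact: ltW|rewrite /tau; lra].
  by move: H; rewrite ler_norml => /andP[h1 h2]; lra.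
Qed.

(** The state equation is affine in the investment, and the value is concave in it. *)
Let near_optimal_midpoint e f g : near_optimal k M e f -> near_optimal k M e g ->
  near_optimal k M e (fun t => (f t + g t) / 2).
Proof.
move=> [mf fk fmot fval] [mg gk gmot gval].
have mfg : measurable_fun [set: R] (fun t => (f t + g t) / 2).
  by apply: measurable_funM => //; exact: measurable_funD.
have fgk t : 0 <= (f t + g t) / 2 <= ph (k t).
  by have /andP[? ?] := fk t; have /andP[? ?] := gk t; apply/andP; split; lra.
split => //.
- move=> x xD.
  have -> : \int[lebesgue R]_(t in `[t0, x]) ((f t + g t) / 2 - sigma * k t) =
      \int[lebesgue R]_(t in `[t0, x])
        (((f t - sigma * k t) + (g t - sigma * k t)) / 2).
    by apply: eq_Rintegral => t _; field.
  rewrite (@Rintegral_midpoint _ _ _ _ _ L).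
  + have := fmot x xD; have := gmot x xD; rewrite !ler_norml => /andP[? ?] /andP[? ?].
    by apply/andP; split; lra.
  + exact: measurable_motion.
  + exact: measurable_motion.
  + by move=> t _; exact: motion_bound.
  + by move=> t _; exact: motion_bound.
- have [W HW] := payoff_bound.
  apply: (@le_trans _ _ ((value k f + value k g) / 2)); first lra.
  rewrite /value -(@Rintegral_midpoint _ _ _ _ _ W); first last.
  + by move=> t; exact: HW.
  + by move=> t; exact: HW.
  + exact: measurable_payoff.
  + exact: measurable_payoff.
  apply: le_Rintegral => //.
  + apply: (@integrable_bounded_itv _ _ _ _ W).
      apply: measurable_funTS; apply: measurable_funM => //.
      by apply: measurable_funD; exact: measurable_payoff.
    move=> t tD; have := HW _ _ _ kB fk tD; have := HW _ _ _ kB gk tD.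
    rewrite !ler_norml => /andP[? ?] /andP[? ?].
    by apply/andP; split; lra.
  + apply: (@integrable_bounded_itv _ _ _ _ W).
      by apply: measurable_funTS; exact: measurable_payoff.
    by move=> t tD; exact: HW.
  + move=> t _; rewrite /payoff -mulrDl mulrAC ler_wpM2r ?expR_ge0//.
    have /andP[f0 fp] := fk t; have /andP[g0 gp] := gk t.
    have fp0 : 0 <= ph (k t) - f t by rewrite subr_ge0.
    have gp0 : 0 <= ph (k t) - g t by rewrite subr_ge0.
    have := @concave_halfline _ _ omega_concave 2^-1 (ph (k t) - f t) (ph (k t) - g t).
    have h1 : 0 <= (2^-1 : R) <= 1 by lra.
    move=> /(_ h1 fp0 gp0).
    rewrite (omE fp0) (omE gp0) omE; last by lra.
    have -> : 2^-1 * (ph (k t) - f t) + (1 - 2^-1) * (ph (k t) - g t) =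
      ph (k t) - (f t + g t) / 2 by field.
    lra.
Qed.

(** The almost everywhere limit of near optimal investments with vanishing error is
admissible and reaches the value M. *)
Lemma near_optimal_limit :
  (forall e, 0 < e -> near_optimal k M e !=set0) ->
  exists u, admissible k u /\ M <= value k u.
Proof.
move=> NO.
pose C n := near_optimal k M n.+1%:R^-1.
have [|||||||h [Ch ch]] := @decreasing_convex_ae_cvg _ _ _ (lebesgue R)
    `[t0, T]%classic Phi _ _ C.
- exact: measurable_itv.
- by rewrite [ltLHS]lebesgue_measure_itv/=; case: ifPn => // _; rewrite -EFinB ltry.
- by move=> n g [mg _ _ _]; exact: measurable_funTS.
- move=> n g t [_ gk _ _] _; have /andP[g0 gp] := gk t; have /andP[_ pP] := phB t.
  by rewrite ger0_norm// (le_trans gp).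
- by move=> n f g; exact: near_optimal_midpoint.
- move=> m n mn g [mg gk gmot gval].
  have mn' : (n.+1%:R^-1 : R) <= m.+1%:R^-1 by rewrite lef_pV2 ?posrE// ler_nat.
  split => //; first by move=> x xD; exact: le_trans (gmot x xD) mn'.
  by apply: le_trans gval; rewrite lerD2l lerN2.
- by move=> n; apply: NO; rewrite invr_gt0.
have mh j : measurable_fun [set: R] (h j) by have [] := Ch j.
have hk j t : 0 <= h j t <= ph (k t) by have [] := Ch j.
pose w t := limn_sup (fun j => h j t).
have mw : measurable_fun [set: R] w.
  apply: measurable_fun_limn_sup => //.
    by move=> t _; exists (ph (k t)) => _ [j _ <-]; have /andP[] := hk j t.
  by move=> t _; exists 0 => _ [j _ <-]; have /andP[] := hk j t.
(* At the times of [t0, T] where h_j converges, clamping has no effect. *)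
pose u t := clamp 0 (ph (k t)) (w t).
have mu : measurable_fun [set: R] u.
  apply: (@measurable_maxr _ _ _ _ (cst 0) _) => //.
  exact: (@measurable_minr _ _ _ _ w).
have uk t : 0 <= u t <= ph (k t) by exact: clamp_itv.
have hu : {ae lebesgue R, forall t, t0 <= t <= T -> h j t @[j --> \oo] --> u t}.
  apply: filterS ch => t H tD; have {H} : cvgn (fun j => h j t).
    by apply: H; rewrite /= in_itv/=.
  move=> /cvg_ex[l hl]; suff -> : u t = l by [].
  rewrite /u /w (cvg_limn_inf_sup hl).2 clamp_id//; apply/andP; split.
    by apply: (cvgr_to_ge hl); apply: nearW => j; have /andP[] := hk j t.
  by apply: (cvgr_to_le hl); apply: nearW => j; have /andP[] := hk j t.
exists u; split; first split => //.
- move=> x /andP[tx xT].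
  have cI : \int[lebesgue R]_(t in `[t0, x]) (h j t - sigma * k t) @[j --> \oo] -->
      \int[lebesgue R]_(t in `[t0, x]) (u t - sigma * k t).
    apply: (@Rintegral_dominated_cvg _ _ _ L) => //.
    + by move=> j; exact: measurable_motion.
    + exact: measurable_motion.
    + by move=> j t _; exact: motion_bound.
    + apply: filterS hu => t H /andP[tt tlex].
      by apply: cvgB; [apply: H; rewrite tt (le_trans tlex)|exact: cvg_cst].
  apply/eqP; rewrite addrC -subr_eq; apply/eqP.
  apply: (@cvg_unique _ (@Rhausdorff R) _ _ _ _ _ cI).
  apply/cvgrPdist_le => e e0; near=> j.
  have [_ _ /(_ x) + _] := Ch j; rewrite tx xT => /(_ isT).
  rewrite opprD addrA => /le_trans; apply; apply: ltW.
  by near: j; exact: (near_infty_natSinv_lt (PosNum e0)).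
- have [W HW] := payoff_bound.
  have cV : value k (h j) @[j --> \oo] --> value k u.
    apply: (@Rintegral_dominated_cvg _ _ _ W).
    + by move=> j; exact: measurable_payoff.
    + exact: measurable_payoff.
    + by move=> j t tD; exact: HW.
    + apply: filterS hu => t H tD.
      have c1 : ph (k t) - h j t @[j --> \oo] --> ph (k t) - u t.
        by apply: cvgB; [exact: cvg_cst|exact: H].
      have c2 : om (ph (k t) - h j t) @[j --> \oo] --> om (ph (k t) - u t).
        by apply: continuous_cvg; [exact: om_cont|exact: c1].
      exact: cvgM c2 (cvg_cst _).
  have cM : value k (h j) + j.+1%:R^-1 @[j --> \oo] --> value k u + 0.
    by apply: cvgD => //; exact: cvg_harmonic.
  rewrite -[leRHS]addr0; apply: (cvgr_to_ge cM); apply: nearW => j.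
  by have [_ _ _] := Ch j; rewrite lerBlDr.
Unshelve. all: by end_near. Qed.

End limit_state.

Lemma admissible_maximizer : exists k u, admissible k u /\
  forall k1 u1, admissible k1 u1 -> value k1 u1 <= value k u.
Proof.
have [W HW] := payoff_bound.
pose S := [set x | exists k u, admissible k u /\ value k u = x].
have supS : has_sup S.
  split; first by have [k [u adm]] := admissible_exists; exists (value k u), k, u.
  exists (W * (T - t0)) => _ [k [u [[kL kB mu uk _] <-]]].
  apply: (le_trans (ler_norm _)); apply: Rintegral_norm_le_itv; first exact: ltW.
    apply: measurable_funTS; apply: measurable_payoff => //.
    by apply: continuous_measurable_fun; exact: Lipschitz_continuous kL.
  by move=> t; exact: HW.
pose M := sup S.
have maximizing (n : nat) : exists ku : (R -> R) * (R -> R),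
    admissible ku.1 ku.2 /\ M - n.+1%:R^-1 <= value ku.1 ku.2.
  have n0 : (0 : R) < n.+1%:R^-1 by rewrite invr_gt0.
  have [_ [k [u [adm <-]]] /ltW kM] := sup_adherent n0 supS.
  by exists (k, u).
have [K HK] := choice maximizing.
have KL n := adm_Lipschitz (HK n).1.
have KB n := adm_state (HK n).1.
have [k [kL kK]] := @equiLipschitz_cluster _ t0 T 0 B L (fun n => (K n).1) L_ge0 KB KL.
have cD t : t0 <= clamp t0 T t <= T by exact: clamp_itv (ltW _).
pose k' t := k (clamp t0 T t).
have k'L s t : `|k' s - k' t| <= L * `|s - t|.
  apply: (le_trans (kL _ _)); apply: ler_wpM2l => //; exact: clamp_Lipschitz.
have k'B t : 0 <= k' t <= B.
  apply/andP; split; apply/ler_addgt0Pr => e e0;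
    have [n _ /(_ _ (cD t))] := kK e 0%N e0; have /andP[] := KB n (clamp t0 T t);
    rewrite ler_norml /k' => ? ? /andP[? ?]; lra.
have [u [adm Mu]] : exists u, admissible k' u /\ M <= value k' u.
  apply: near_optimal_limit => // e e0; apply: near_optimal_nonempty => // d d0.
  have [N _ HN] := near_infty_natSinv_lt (PosNum d0).
  have [n Nn Hn] := kK d N d0.
  exists (K n).1, (K n).2; split; first exact: (HK n).1.
    have nd : n.+1%:R^-1 < d := HN n Nn.
    by apply: le_trans (HK n).2; rewrite lerD2l lerN2 ltW.
  by move=> t tD; rewrite /k' clamp_id//; exact: Hn.
exists k', u; split => // k1 u1 adm1.
apply: le_trans Mu; apply: ub_le_sup; first exact: supS.2.
by exists k1, u1.
Qed.

Lemma growth_problem_global_solution :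
  exists k s, global_solution F omega t0 T lambda sigma k0 k s.
Proof.
have [k [u [adm kmax]]] := admissible_maximizer.
have [s [feas objE]] := admissible_feasible adm.
exists k, s; split => // k' s' feas'.
have [k1 [u1 [adm1 ->]]] := feasible_admissible feas'.
by rewrite objE; exact: kmax.
Qed.

End growth.

Theorem theorem3p2 (R : realType) (F : R -> R -> R) (omega : R -> R)
    (t0 T lambda sigma k0 : R)
    (F_production : production_function F)
    (t0_ge0 : 0 <= t0) (t0_lt_T : t0 < T)
    (lambda_ge0 : 0 <= lambda) (sigma_gt0 : 0 < sigma) (k0_gt0 : 0 < k0)
    (omega_continuous : {within `[0, +oo[, continuous omega})
    (omega_concave : concave_function `[0, +oo[ omega)
    (phi_continuous : {within `[0, +oo[, continuous (per_capita F)})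
    (phi_concave : concave_function `[0, +oo[ (per_capita F)) :
  exists k s : R -> R, global_solution F omega t0 T lambda sigma k0 k s.
Proof. exact: growth_problem_global_solution. Qed.
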